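(* Let $\lambda\in\mathcal P_{r,n}$, let $T\in NST(\lambda)$ and $S\in ST(\lambda)$, and let $\mathbf D\in\mathcal D_V$ be such that $\mathbf D(F_T^S)\neq0$. Then the image $\mathbf D(V^S(\lambda))$ of the $\mathbb C[S_{n_1}\times\cdots\times S_{n_r}]$-module $V^S(\lambda)$ under $\mathbf D$ is a $\mathbb C[S_{n_1}\times\cdots\times S_{n_r}]$-module isomorphic to $V^S(\lambda)$.
   Context: Setting. Let $n_1,\dots,n_r$ be positive integers, $n=\sum_i n_i$, $m_i=n_1+\cdots+n_{i-1}$ (so $m_1=0$), and $B_i=\{m_i+1,\dots,m_i+n_i\}$. The group $S_{n_1}\times\cdots\times S_{n_r}\subset S_n$ (the $i$-th factor permuting $B_i$) acts on $\mathcal O_X=\mathbb C[x_1,\dots,x_n]$ by $(\sigma f)(x_1,\dots,x_n)=f(x_{\sigma(1)},\dots,x_{\sigma(n)})$. Write $\mathcal O_Y=\mathcal O_X^{S_{n_1}\times\cdots\times S_{n_r}}=\mathbb C[y_1,\dots,y_n]$, where the $y_j$ with $j\in B_i$ are algebraically independent generators (e.g. the elementary symmetric polynomials) of $\mathbb C[x_j: j\in B_i]^{S_{n_i}}$. Put $\Delta=\prod_i\prod_{k<l,\ k,l\in B_i}(x_k-x_l)$, $\mathcal O_U=\mathbb C[x_1,\dots,x_n,\Delta^{-1}]$, $\mathcal O_V=\mathbb C[y_1,\dots,y_n,\Delta^{-2}]$, and $\mathcal D_V=\mathbb C\langle y_1,\dots,y_n,\partial/\partial y_1,\dots,\partial/\partial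 y_n,\Delta^{-2}\rangle$ (the localized Weyl algebra). $\mathcal O_U$ is a left $\mathcal D_V$-module: $\mathcal O_V$ acts by multiplication and $\partial/\partial y_j$ acts by the unique extension of this derivation of $\mathcal O_V$ to $\mathcal O_U$ (which is finite étale over $\mathcal O_V$). The group acts on $\mathcal O_U$ by permuting variables. Tableaux. $\mathcal P_{r,n}$ is the set of $r$-diagrams of type $(n_1,\dots,n_r)$, i.e. $r$-tuples $\lambda=(\lambda^1,\dots,\lambda^r)$ of partitions with $\lambda^i\vdash n_i$. An $r$-tableau of shape $\lambda$ is a tuple $T=(T^1,\dots,T^r)$ of fillings of the $\lambda^i$; it is standard if each of $1,\dots,n$ appears exactly once and every row and column of each $T^i$ is strictly increasing; it is natural if moreover the set of entries of $T^i$ is $B_i$ for each $i$. $ST(\lambda)$ and $NST(\lambda)$ are the sets of standard, respectively natural standard, $r$-tableaux of shape $\lambda$. Young symmetrizers. $e_{T^i}=\frac{f^{\lambda^i}}{n_i!}\sum_{\sigma\in R(T^i),\ \tau\in C(T^i)}\operatorname{sgn}(\tau)\,\tau\sigma$, where $R(T^i)$, $C(T^i)$ are the row and column stabilizers and $f^{\lambda^i}$ is the number of standard tableaux of shape $\lambda^i$; $e_T=e_{T^1}\cdots e_{T^r}$. Higher Specht polynomials. The word $w(S)$ of $S\in ST(\lambda)$ is obtained by reading the columns of $S^1$ from bottom to top, starting from the left, then those of $S^2$, and so on. The number $1$ has index $0$; if $k$ has index $p$, then $k+1$ has index $p$ if it lies to the right of $k$ in $w(S)$ and $p+1$ if it lies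 to the left. Replacing each entry of $S$ by its index gives $i(S)$. Put $x_T^{i(S)}=\prod_b x_{T(b)}^{i(S)(b)}$, product over all boxes $b$ of $\lambda$, and $F_T^S=e_T(x_T^{i(S)})$. For $S\in ST(\lambda)$, $V^S(\lambda)$ is the $\mathbb C$-span of $\{F_T^S: T\in NST(\lambda)\}$; it is known that these polynomials form a basis of $V^S(\lambda)$ and that $V^S(\lambda)$ is an irreducible $\mathbb C[S_{n_1}\times\cdots\times S_{n_r}]$-module (the one indexed by $\lambda$). *)

(* Defs.v *)
From HB Require Import structures.
From mathcomp Require Import all_boot all_order all_algebra all_fingroup.
From mathcomp Require Import reals complex mpoly generic_quotient.

Set Implicit Arguments.
Unset Strict Implicit.
Unset Printing Implicit Defensive.

Import GRing.Theory.
Local Open Scope ring_scope.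
Local Open Scope complex_scope.

(* Indices and tableau entries are elements of 'I_n, hence shifted down by one:
   the number k of the literature is the ordinal of value k - 1. *)

Definition ntot (r : nat) (ns : 'I_r -> nat) : nat := (\sum_(i < r) ns i)%N.

Definition offset (r : nat) (ns : 'I_r -> nat) (i : 'I_r) : nat :=
  (\sum_(j < r | (j < i)%N) ns j)%N.

Definition block (r : nat) (ns : 'I_r -> nat) (i : 'I_r) : {set 'I_(ntot ns)} :=
  [set k : 'I_(ntot ns) | (offset ns i <= k < offset ns i + ns i)%N].

Definition young_subgroup (r : nat) (ns : 'I_r -> nat) : {set 'S_(ntot ns)} :=
  [set s : 'S_(ntot ns) | [forall i, s @: block ns i == block ns i]].

Definition is_intpart (k : nat) (s : seq nat) : bool :=
  [&& sorted geq s, 0%N \notin s & sumn s == k].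

Definition intpart (k : nat) := {s : seq nat | is_intpart k s}.

Definition rdiagram (r : nat) (ns : 'I_r -> nat) := forall i : 'I_r, intpart (ns i).

(* Rows are numbered from top to bottom and columns from left to right. *)
Definition cell (s : seq nat) : finType := {p : 'I_(size s) & 'I_(nth 0%N s p)}.

Definition crow (s : seq nat) (c : cell s) : nat := tag c.
Definition ccol (s : seq nat) (c : cell s) : nat := tagged c.

Definition tableau (s : seq nat) (k : nat) : finType := {ffun cell s -> 'I_k}.

Definition increasing (s : seq nat) (k : nat) (t : tableau s k) : bool :=
  [forall c : cell s, forall c' : cell s,
     ((crow c == crow c') && (ccol c < ccol c')%N
      || (ccol c == ccol c') && (crow c < crow c')%N) ==> (t c < t c')%N].

(* The number f^s of standard tableaux of shape s. *)
Definition nb_std (s : seq nat) : nat :=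
  #|[set t : tableau s (sumn s) |
      [forall k, #|[set c | t c == k]| == 1%N] && increasing t]|.

Definition rtableau (r : nat) (ns : 'I_r -> nat) (lam : rdiagram ns) : finType :=
  {dffun forall i : 'I_r, tableau (sval (lam i)) (ntot ns)}.

Definition ST (r : nat) (ns : 'I_r -> nat) (lam : rdiagram ns) :
    {set rtableau lam} :=
  [set T : rtableau lam |
     [forall k, #|[set b : {i : 'I_r & cell (sval (lam i))} |
                    T (tag b) (tagged b) == k]| == 1%N]
     && [forall i, increasing (T i)]].

Definition NST (r : nat) (ns : 'I_r -> nat) (lam : rdiagram ns) :
    {set rtableau lam} :=
  [set T : rtableau lam in ST lam |
     [forall i, [set T i c | c : cell (sval (lam i))] == block ns i]].

Definition row_entries (s : seq nat) (k : nat) (t : tableau s k) (p : nat) :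
    {set 'I_k} :=
  [set t c | c : cell s & crow c == p].

Definition col_entries (s : seq nat) (k : nat) (t : tableau s k) (q : nat) :
    {set 'I_k} :=
  [set t c | c : cell s & ccol c == q].

Definition row_stab (s : seq nat) (k : nat) (t : tableau s k) : {set 'S_k} :=
  [set g : 'S_k | perm_on [set t c | c : cell s] g &&
     [forall c : cell s,
        g @: row_entries t (crow c) == row_entries t (crow c)]].

Definition col_stab (s : seq nat) (k : nat) (t : tableau s k) : {set 'S_k} :=
  [set g : 'S_k | perm_on [set t c | c : cell s] g &&
     [forall c : cell s,
        g @: col_entries t (ccol c) == col_entries t (ccol c)]].

(* The inner filter selects the unique box in row pq.2 of column pq.1, if any. *)
Definition word1 (s : seq nat) (k : nat) (t : tableau s k) : seq nat :=
  [seq val (t c) |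
    pq <- [seq (q, p) | q <- iota 0 (head 0%N s), p <- rev (iota 0 (size s))],
    c <- [seq c <- enum (cell s) | (ccol c == pq.1) && (crow c == pq.2)]].

Definition word (r : nat) (ns : 'I_r -> nat) (lam : rdiagram ns)
    (S : rtableau lam) : seq nat :=
  flatten [seq word1 (S i) | i <- enum 'I_r].

Fixpoint word_index (w : seq nat) (k : nat) : nat :=
  if k is k'.+1
  then (if index k' w < index k w then word_index w k' else (word_index w k').+1)%N
  else 0%N.

Definition tab_index (r : nat) (ns : 'I_r -> nat) (lam : rdiagram ns)
    (S : rtableau lam) (i : 'I_r) (c : cell (sval (lam i))) : nat :=
  word_index (word S) (S i c).

(* [msym s] substitutes 'X_(s i) for 'X_i.  MathComp composes permutations from
   left to right, so that the group algebra element [tau sigma] acts as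
   [msym tau \o msym sigma], that is, as [msym (sigma * tau)]. *)
Definition young_sym (R : realType) (s : seq nat) (k : nat) (t : tableau s k)
    (p : {mpoly R[i][k]}) : {mpoly R[i][k]} :=
  ((nb_std s)%:R / ((sumn s)`!)%:R) *:
    \sum_(g in row_stab t) \sum_(h in col_stab t)
      (-1) ^+ odd_perm h *: msym h (msym g p).

Definition young_rsym (R : realType) (r : nat) (ns : 'I_r -> nat)
    (lam : rdiagram ns) (T : rtableau lam) (p : {mpoly R[i][ntot ns]}) :
    {mpoly R[i][ntot ns]} :=
  foldr (fun i q => young_sym (T i) q) p (enum 'I_r).

Definition specht_monomial (R : realType) (r : nat) (ns : 'I_r -> nat)
    (lam : rdiagram ns) (T S : rtableau lam) : {mpoly R[i][ntot ns]} :=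
  \prod_(i < r) \prod_(c : cell (sval (lam i))) 'X_(T i c) ^+ tab_index S c.

Definition higher_specht (R : realType) (r : nat) (ns : 'I_r -> nat)
    (lam : rdiagram ns) (T S : rtableau lam) : {mpoly R[i][ntot ns]} :=
  young_rsym T (specht_monomial R T S).

Definition ratfun (R : realType) (n : nat) := {fraction {mpoly R[i][n]}}.

Definition cst (R : realType) (n : nat) (c : R[i]) : ratfun R n :=
  tofrac (c%:MP : {mpoly R[i][n]}).

Definition vdm (R : realType) (r : nat) (ns : 'I_r -> nat) :
    {mpoly R[i][ntot ns]} :=
  \prod_(i < r) \prod_(k in block ns i) \prod_(l in block ns i | (k < l)%N)
    ('X_k - 'X_l).

Definition in_OU (R : realType) (r : nat) (ns : 'I_r -> nat)
    (f : ratfun R (ntot ns)) : Prop :=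
  exists (p : {mpoly R[i][ntot ns]}) (k : nat),
    f = tofrac p / tofrac (vdm R ns) ^+ k.

(* The quotient p / q is sent to [msym s p / msym s q], whatever the choice of
   numerator and denominator: see [act_frac]. *)
Definition act (R : realType) (n : nat) (s : 'S_n) (f : ratfun R n) : ratfun R n :=
  tofrac (msym s (\n_(repr f))) / tofrac (msym s (\d_(repr f))).

Lemma fracE (A : idomainType) (x : {fraction A}) :
  tofrac (\n_(repr x)) / tofrac (\d_(repr x)) = x.
Proof.
have d0 : tofrac (\d_(repr x)) != 0 by rewrite tofrac_eq0 denom_ratioP.
apply: (mulIf d0); rewrite mulfVK // -[in RHS](reprK x).
unlock FracField.tofrac; rewrite -[RHS]FracField.pi_mul; apply/eqmodP.
rewrite /= FracField.equivfE /FracField.mulf.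
rewrite !numden_Ratio ?mulf_neq0 ?oner_neq0 //; try exact: denom_ratioP.
by rewrite reprK mul1r mulr1.
Qed.

Lemma frac_map_rep (A : idomainType) (h : A -> A) (p q : A) :
  injective h -> h 0 = 0 -> {morph h : x y / x * y} -> q != 0 ->
  let f := tofrac p / tofrac q in
  tofrac (h (\n_(repr f))) / tofrac (h (\d_(repr f)))
    = tofrac (h p) / tofrac (h q).
Proof.
move=> hI h0 hM q0 f; have := fracE f; have := denom_ratioP (repr f).
move: (\n_(repr f)) (\d_(repr f)) => a b b0 fE.
have nz (u : A) : u != 0 -> tofrac u != 0 by rewrite tofrac_eq0.
have hnz (u : A) : u != 0 -> tofrac (h u) != 0.
  by rewrite tofrac_eq0; apply: contraNN => /eqP hu; apply/eqP/hI; rewrite hu h0.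
have abpq : a * q = p * b.
  apply/eqP; rewrite -tofrac_eq !tofracM.
  by rewrite -(eqr_div _ _ (nz b b0) (nz q q0)) fE.
apply/eqP; rewrite (eqr_div _ _ (hnz b b0) (hnz q q0)).
by rewrite -!tofracM -!hM abpq.
Qed.

Lemma act_frac (R : realType) (n : nat) (s : 'S_n) (p q : {mpoly R[i][n]}) :
  q != 0 ->
  act s (tofrac p / tofrac q) = tofrac (msym s p) / tofrac (msym s q).
Proof. exact: frac_map_rep (@inj_msym _ _ s) (msym0 _ s) (msymM s). Qed.

Definition only_vars (R : realType) (n : nat) (B : {set 'I_n})
    (p : {mpoly R[i][n]}) : Prop :=
  forall m, m \in msupp p -> forall k, k \notin B -> m k = 0%N.

Definition block_invariant (R : realType) (r : nat) (ns : 'I_r -> nat) (i : 'I_r)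
    (p : {mpoly R[i][ntot ns]}) : Prop :=
  only_vars (block ns i) p /\
  forall s : 'S_(ntot ns), perm_on (block ns i) s -> msym s p = p.

(* For each i, the y_j with j in the i-th block are algebraically independent
   generators of the algebra of block invariants. *)
Definition invariant_coords (R : realType) (r : nat) (ns : 'I_r -> nat)
    (y : (ntot ns).-tuple {mpoly R[i][ntot ns]}) : Prop :=
  forall i : 'I_r,
    [/\ forall j, j \in block ns i -> block_invariant i (tnth y j),
        forall p, block_invariant i p ->
          exists2 q, only_vars (block ns i) q & p = q \mPo y
      & forall q, only_vars (block ns i) q -> q \mPo y = 0 -> q = 0].

(* [d] represents an operator on O_U; its values outside of O_U are irrelevant. *)
Definition is_derivation_OU (R : realType) (r : nat) (ns : 'I_r -> nat)
    (d : ratfun R (ntot ns) -> ratfun R (ntot ns)) : Prop :=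
  [/\ forall f, in_OU f -> in_OU (d f),
      forall c f g, in_OU f -> in_OU g ->
        d (cst (ntot ns) c * f + g) = cst (ntot ns) c * d f + d g
    & forall f g, in_OU f -> in_OU g -> d (f * g) = d f * g + f * d g].

(* [d] is the extension to O_U of the partial derivative with respect to y_j.
   As O_V is a localization of C[y], it suffices to prescribe [d] on C[y]. *)
Definition is_ddy (R : realType) (r : nat) (ns : 'I_r -> nat)
    (y : (ntot ns).-tuple {mpoly R[i][ntot ns]}) (j : 'I_(ntot ns))
    (d : ratfun R (ntot ns) -> ratfun R (ntot ns)) : Prop :=
  is_derivation_OU d /\
  forall p : {mpoly R[i][ntot ns]},
    d (tofrac (p \mPo y)) = tofrac (p^`M(j) \mPo y).

(* The operators by which the elements of D_V = C<y, d/dy, Delta^-2> act on O_U. *)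
Inductive in_DV (R : realType) (r : nat) (ns : 'I_r -> nat)
    (y : (ntot ns).-tuple {mpoly R[i][ntot ns]})
    (dy : 'I_(ntot ns) -> ratfun R (ntot ns) -> ratfun R (ntot ns)) :
    (ratfun R (ntot ns) -> ratfun R (ntot ns)) -> Prop :=
| DV_cst (c : R[i]) : in_DV y dy (fun f => cst (ntot ns) c * f)
| DV_y (j : 'I_(ntot ns)) : in_DV y dy (fun f => tofrac (tnth y j) * f)
| DV_dy (j : 'I_(ntot ns)) : in_DV y dy (dy j)
| DV_Delta : in_DV y dy (fun f => tofrac (vdm R ns) ^- 2 * f)
| DV_add D1 D2 : in_DV y dy D1 -> in_DV y dy D2 ->
    in_DV y dy (fun f => D1 f + D2 f)
| DV_mul D1 D2 : in_DV y dy D1 -> in_DV y dy D2 ->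
    in_DV y dy (fun f => D1 (D2 f)).

Definition is_CGmodule (R : realType) (r : nat) (ns : 'I_r -> nat)
    (V : ratfun R (ntot ns) -> Prop) : Prop :=
  [/\ V 0,
      forall c f g, V f -> V g -> V (cst (ntot ns) c * f + g)
    & forall s f, s \in young_subgroup ns -> V f -> V (act s f)].

Definition CG_isomorphic (R : realType) (r : nat) (ns : 'I_r -> nat)
    (V W : ratfun R (ntot ns) -> Prop) : Prop :=
  [/\ is_CGmodule V, is_CGmodule W &
      exists phi : ratfun R (ntot ns) -> ratfun R (ntot ns),
        [/\ forall f, V f -> W (phi f),
            forall c f g, V f -> V g ->
              phi (cst (ntot ns) c * f + g) = cst (ntot ns) c * phi f + phi g,
            forall s f, s \in young_subgroup ns -> V f ->
              phi (act s f) = act s (phi f),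
            forall f g, V f -> V g -> phi f = phi g -> f = g
          & forall g, W g -> exists2 f, V f & phi f = g]].

Definition specht_module (R : realType) (r : nat) (ns : 'I_r -> nat)
    (lam : rdiagram ns) (S : rtableau lam) (f : ratfun R (ntot ns)) : Prop :=
  exists a : rtableau lam -> R[i],
    f = tofrac (\sum_(T in NST lam) a T *: higher_specht R T S).

Arguments specht_module R {r ns lam} S f.

Definition image_of (A B : Type) (D : A -> B) (V : A -> Prop) (g : B) : Prop :=
  exists2 f, V f & g = D f.

(* Main.v *)
Require Import Defs.
From HB Require Import structures.
From mathcomp Require Import all_boot all_order all_algebra all_fingroup.
From mathcomp Require Import reals complex mpoly generic_quotient.
From mathcomp Require boolp.

Set Implicit Arguments.
Unset Strict Implicit.
Unset Printing Implicit Defensive.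

Import Defs GRing.Theory Num.Theory.
Local Open Scope ring_scope.
Local Open Scope complex_scope.

(** Why the theorem holds.  An operator D of D_V is C-linear on O_U and commutes
    with the action of the Young subgroup G, so it is enough to see that D is
    injective on V = V^S(lambda): its restriction to V is then an isomorphism
    onto D(V).  The kernel of D in V is a G-submodule of V that does not contain
    F_T^S, hence it vanishes because V is irreducible.

    Equivariance ([DV_equivariant]).  The y_j and Delta^2 are G-invariant, so only
    the derivations d/dy_j matter.  Conjugating one of them by an element of G
    gives a derivation that takes the same values on C[y], and a derivation of O_U
    is determined by its restriction to C[y] ([derivation_eq0]): each x_k is a
    simple root of the product of the t - x_l over the block of k, a polynomial
    whose coefficients are invariant.

    G-stability of V ([straightening]).  V is spanned by the F_T^S for T natural
    standard, and one has to express F_(sT)^S for any s in G through them.  This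
    is the classical straightening with Garnir relations.  A potential, weighing
    each entry by its column first and by its row next, increases whenever a
    violation of standardness is repaired.

    Irreducibility ([young_irreducible]).  Up to a scalar F_T^S is
    kappa (rho x), where rho sums over the row group, kappa is the signed sum over
    the column group and x is a monomial.  By von Neumann's lemma, rho g kappa is a
    multiple of rho kappa for every g in G, and likewise with rho and kappa
    exchanged ([row_col_proportional], [col_row_proportional]).  Positivity of the
    coefficientwise Hermitian product on polynomials, which is G-invariant and for
    which rho and kappa are self-adjoint, shows that the multiples that have to be
    nonzero are so.  Hence any nonzero v in V yields F_T^S through the action of
    the group algebra.

    All the combinatorics takes place on the entries of T rather than on its
    boxes: a [layout] records the component, the row and the column of each entry.
    The r diagrams are thus treated as a single one, and [young_rsymE] identifies
    the product of the r Young symmetrizers with one double sum. *)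

(** * Layouts of entries, row groups and column groups *)

(** Exchanging elements for strictly lighter ones decreases the total weight.  The
    two uses are at opposite ends: initial segments have the least sum among sets
    of naturals of their size, and a Garnir move brings lighter entries to the left. *)
Lemma leqif_exchange (U : finType) (w : U -> nat) (X Z : {set U}) :
  #|X| = #|Z| ->
  (forall x z, x \in X :\: Z -> z \in Z :\: X -> (w z < w x)%N) ->
  (\sum_(u in Z) w u <= \sum_(u in X) w u ?= iff (X == Z))%N.
Proof.
move=> cXZ lt_w.
have cD : #|X :\: Z| = #|Z :\: X|.
  by apply: (@addnI #|X :&: Z|); rewrite cardsID setIC cardsID.
have [Z0 | [z0 z0Z]] := set_0Vmem (Z :\: X).
  have sZX : Z \subset X by rewrite -setD_eq0 Z0.
  have -> : X = Z by apply/esym/eqP; rewrite eqEcard sZX cXZ leqnn.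
  by split=> //; rewrite !eqxx.
have neXZ : (X == Z) = false.
  by apply/negbTE; apply: contraTneq z0Z => ->; rewrite setDv inE.
have lt : (\sum_(u in Z) w u < \sum_(u in X) w u)%N.
  rewrite (big_setID X) [X in (_ < X)%N](big_setID Z) /= setIC ltn_add2l.
  pose m := (\max_(z in Z :\: X) w z)%N.
  have Zm : (\sum_(z in Z :\: X) w z <= #|Z :\: X| * m)%N.
    by rewrite -sum_nat_const leq_sum // => z zZ; apply: leq_bigmax_cond.
  have Xm : (#|X :\: Z| * m.+1 <= \sum_(x in X :\: Z) w x)%N.
    rewrite -sum_nat_const leq_sum // => x xX.
    case: (@eq_bigmax_cond _ (mem (Z :\: X)) w) => [|z zZ mz].
      by apply/card_gt0P; exists z0.
    by rewrite /m mz lt_w.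
  apply: leq_trans Xm; rewrite cD mulnS; apply: leq_ltn_trans Zm _.
  by rewrite -[X in (X < _)%N]add0n ltn_add2r; apply/card_gt0P; exists z0.
by split; [exact: ltnW | rewrite neXZ ltn_eqF].
Qed.

Definition key_stab (n : nat) (K : eqType) (k : 'I_n -> K) : {set 'S_n} :=
  [set g : 'S_n | [forall a, k (g a) == k a]].

Lemma key_stabP (n : nat) (K : eqType) (k : 'I_n -> K) (g : 'S_n) :
  reflect (forall a, k (g a) = k a) (g \in key_stab k).
Proof. by rewrite inE; apply: (iffP forallP) => h a; apply/eqP; rewrite h. Qed.

Lemma group_set_key_stab (n : nat) (K : eqType) (k : 'I_n -> K) :
  group_set (key_stab k).
Proof.
apply/group_setP; split=> [|g h /key_stabP kg /key_stabP kh].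
  by apply/key_stabP => a; rewrite perm1.
by apply/key_stabP => a; rewrite permM kh kg.
Qed.

Canonical key_stab_group n K k := Group (@group_set_key_stab n K k).

Lemma tperm_key_stab (n : nat) (K : eqType) (k : 'I_n -> K) (a b : 'I_n) :
  k a = k b -> tperm a b \in key_stab k.
Proof. by move=> kab; apply/key_stabP => c; case: tpermP => [->|->|]. Qed.

(** The boxes of a multipartition, seen through the entries that fill them.  The
    last field, closure towards the top and the left, expresses that the shapes are
    Young diagrams. *)
Record layout (n r : nat) := Layout {
  comp : 'I_n -> 'I_r;
  row : 'I_n -> nat;
  col : 'I_n -> nat;
  layout_inj : forall a b,
    comp a = comp b -> row a = row b -> col a = col b -> a = b;
  layout_closed : forall a p q, (p <= row a)%N -> (q <= col a)%N ->
    exists b, [/\ comp b = comp a, row b = p & col b = q] }.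

Section Layout.

Variables (n r : nat) (L : layout n r).

Definition row_key (a : 'I_n) := (comp L a, row L a).
Definition col_key (a : 'I_n) := (comp L a, col L a).

Definition comp_group := key_stab_group (comp L).
Definition row_group := key_stab_group row_key.
Definition col_group := key_stab_group col_key.

Lemma row_group_sub : row_group \subset comp_group.
Proof.
by apply/subsetP=> g /key_stabP h; apply/key_stabP => a; case: (h a).
Qed.

Lemma col_group_sub : col_group \subset comp_group.
Proof.
by apply/subsetP=> g /key_stabP h; apply/key_stabP => a; case: (h a).
Qed.

Definition row_bound := (\max_(a : 'I_n) row L a)%N.

(** Row numbers as elements of a finite type, so that sets of them can be
    compared by cardinality. *)
Definition row_ord (a : 'I_n) : 'I_row_bound.+1 := inord (row L a).

Lemma row_ordE a : row_ord a = row L a :> nat.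
Proof. by rewrite inordK // ltnS (leq_bigmax a). Qed.

Lemma row_ord_inj_col (X : {set 'I_n}) k :
  (forall a, a \in X -> col_key a = k) -> {in X &, injective row_ord}.
Proof.
move=> Xk a b /Xk ka /Xk kb /(congr1 val) /=; rewrite !row_ordE => rab.
have [cab qab] : col_key a = col_key b by rewrite ka kb.
exact: layout_inj cab rab qab.
Qed.

(** The combinatorial half of von Neumann's lemma: either g sends two entries of a
    column into a common row, or g is the product of a column permutation and a
    row permutation.  In the second case the entries of a given column q are sent
    into pairwise distinct rows, so the sum of these row numbers is at least
    0 + 1 + ... + (l - 1), where l is the length of the column.  Over all the
    columns both sides add up to the sum of all the row numbers.  Hence equality
    holds everywhere, and the column q has a box in each of the rows that the
    images of its entries lie in; moving each entry to that box is the column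
    permutation. *)
Lemma row_col_factorization (g : 'S_n) : g \in comp_group ->
  (exists a b, [/\ a != b, row_key (g a) = row_key (g b) & col_key a = col_key b])
  \/ (exists al be, [/\ al \in row_group, be \in col_group & g = (be * al)%g]).
Proof.
move=> /key_stabP gG.
have [/existsP[a /existsP[b /and3P[ab /eqP rab /eqP cab]]] | no] :=
  boolP [exists a, exists b, [&& a != b, row_key (g a) == row_key (g b)
                                & col_key a == col_key b]].
  by left; exists a, b.
right.
have inj_g a b : row_key (g a) = row_key (g b) -> col_key a = col_key b -> a = b.
  move=> rab cab; apply/eqP; apply: contraNT no => nab.
  by apply/existsP; exists a; apply/existsP; exists b; rewrite nab rab cab !eqxx.
(* A finite type of column keys, over which the equality of sums is split. *)
pose K : finType := ('I_r * 'I_(\max_(a : 'I_n) col L a).+1)%type.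
pose ck (a : 'I_n) : K :=
  (comp L a, inord (col L a)).
have ckE a b : (ck a == ck b) = (col_key a == col_key b).
  rewrite /ck /col_key !xpair_eqE -[inord _ == _]val_eqE /= !inordK // ltnS;
    exact: leq_bigmax.
pose Ck (k : K) := [set b | ck b == k].
have CkE k b c : b \in Ck k -> c \in Ck k -> col_key b = col_key c.
  by rewrite !inE => /eqP <-; rewrite ckE => /eqP.
have g_inj k : {in Ck k &, injective (fun b => row_ord (g b))}.
  move=> b c bC cC /(congr1 val); rewrite /= !row_ordE => rbc.
  have kk := CkE _ _ _ bC cC.
  by apply: inj_g => //; case: kk => cbc _; rewrite /row_key !gG rbc cbc.
have rowC k : {in Ck k &, injective row_ord}.
  move=> b c bC cC /(congr1 val); rewrite /= !row_ordE => rbc.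
  by have [] := CkE _ _ _ bC cC; move=> cbc colbc; apply: layout_inj cbc rbc colbc.
pose Z k := [set row_ord b | b in Ck k].
pose X k := [set row_ord (g b) | b in Ck k].
have Zdown k (u v : 'I_row_bound.+1) : u \in Z k -> (v <= u)%N -> v \in Z k.
  case/imsetP => b bC -> le_v; rewrite row_ordE in le_v.
  have [c [cc rc qc]] := layout_closed le_v (leqnn (col L b)).
  apply/imsetP; exists c; last by apply: val_inj; rewrite /= row_ordE rc.
  by move: bC; rewrite !inE /ck cc qc.
have leif k : (\sum_(b in Ck k) row L b <= \sum_(b in Ck k) row L (g b)
    ?= iff (X k == Z k))%N.
  have := @leqif_exchange _ (fun u : 'I_row_bound.+1 => val u) (X k) (Z k).
  rewrite !big_imset ?card_in_imset //= ?card_in_imset //.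
  rewrite (eq_bigr _ (fun b _ => row_ordE b)).
  rewrite (eq_bigr _ (fun b _ => row_ordE (g b))); apply => // x z.
  rewrite !inE => /andP[xZ _] /andP[_ zZ]; rewrite ltnNge.
  by apply: contra xZ; apply: Zdown.
have sumC (F : 'I_n -> nat) : (\sum_k \sum_(b in Ck k) F b = \sum_b F b)%N.
  rewrite (partition_big ck predT) //=; apply: eq_bigr => k _.
  by apply: eq_bigl => b; rewrite inE.
have XZ k : X k = Z k.
  have := leqif_sum (fun k (_ : true) => leif k).
  rewrite !sumC; case=> _; rewrite [X in X == _](reindex_inj (@perm_inj _ g)).
  by rewrite eqxx => /esym/forallP/(_ k)/eqP.
(* The box in the column of a and in the row of g a. *)
have beP a : exists b, [/\ comp L b = comp L a, row L b = row L (g a)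
                         & col L b = col L a].
  have : row_ord (g a) \in Z (ck a) by rewrite -XZ; apply/imsetP; exists a; rewrite ?inE.
  case/imsetP => b; rewrite inE ckE => /eqP[cb qb] /(congr1 val).
  by rewrite /= !row_ordE => rb; exists b.
have [be0 be0P] := fin_all_exists beP.
have be0_inj : injective be0.
  move=> a b ab; have [ca ra qa] := be0P a; have [cb rb qb] := be0P b.
  move: ca ra qa; rewrite ab cb rb qb => ca ra qa.
  by apply: inj_g; rewrite /row_key /col_key ?gG ?ca ?ra ?qa.
pose be := perm be0_inj.
exists (be^-1 * g)%g, be; split; last by rewrite mulKVg.
  apply/key_stabP => a; rewrite permM /row_key gG.
  by have [] := be0P (be^-1 a)%g; rewrite -(permE be0_inj) permKV => -> ->.
apply/key_stabP => a; rewrite permE /col_key.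
by have [-> _ ->] := be0P a.
Qed.

(** The boxes of X (column of e, from e downwards) and of Y (column of f, from f
    upwards) outnumber the rows of the column of e, and a column
    permutation keeps them in these rows. *)
Lemma garnir_pigeonhole (e f : 'I_n) (h : 'S_n) :
  comp L e = comp L f -> row L e = row L f -> (col L e < col L f)%N ->
  h \in col_group ->
  let X := [set a | (col_key a == col_key e) && (row L e <= row L a)%N] in
  let Y := [set a | (col_key a == col_key f) && (row L a <= row L f)%N] in
  exists a b, [/\ a \in X :|: Y, b \in X :|: Y, a != b
                & row_key (h^-1 a)%g = row_key (h^-1 b)%g].
Proof.
move=> cef ref lt_ef hC X Y.
have hVC : (h^-1)%g \in col_group by rewrite groupV.
have /key_stabP hK := hVC.
pose C := [set a | col_key a == col_key e].
have rowC : {in C &, injective row_ord}.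
  by apply: (@row_ord_inj_col C (col_key e)) => a; rewrite inE => /eqP.
have XY0 : [disjoint X & Y].
  apply/pred0P => a /=; rewrite !inE; apply/negP=> /andP[/andP[/eqP-> _]].
  by case/andP=> /eqP[_ qq] _; rewrite qq ltnn in lt_ef.
have inC (a : 'I_n) : a \in X :|: Y -> row_ord (h^-1 a)%g \in row_ord @: C.
  rewrite !inE => /orP[] /andP[/eqP ka le_a].
    by rewrite imset_f // inE hK ka.
  have [ch qh] : col_key (h^-1 a)%g = col_key f by rewrite hK ka.
  have le_q : (col L e <= col L (h^-1 a)%g)%N by rewrite qh ltnW.
  have [c [cc rc qc]] := layout_closed (leqnn (row L (h^-1 a)%g)) le_q.
  apply/imsetP; exists c; last by apply: val_inj; rewrite /= !row_ordE rc.
  by rewrite inE /col_key cc ch qc cef.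
have lt_card : (#|row_ord @: C| < #|X :|: Y|)%N.
  rewrite card_in_imset // cardsU disjoint_setI0 // cards0 subn0.
  rewrite -(cardsID [set a | (row L e <= row L a)%N] C).
  have -> : C :&: [set a | (row L e <= row L a)%N] = X.
    by apply/setP=> a; rewrite !inE.
  rewrite ltn_add2l; set C' := C :\: _.
  have eC : e \notin C' by rewrite !inE leqnn.
  have : (#|e |: C'| <= #|Y|)%N; last by rewrite cardsU1 eC.
  have sC : {subset e |: C' <= C}.
    by move=> a; rewrite !inE => /orP[/eqP->|/andP[]].
  rewrite -(@card_in_imset _ _ row_ord); last by move=> a b /sC + /sC; apply: rowC.
  apply: leq_trans (leq_imset_card row_ord Y); apply: subset_leq_card.
  apply/subsetP=> _ /imsetP[a aC ->].
  have le_a : (row L a <= row L f)%N.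
    move: aC; rewrite !inE => /orP[/eqP->|]; first by rewrite ref.
    by rewrite -ltnNge -ref => /andP[/ltnW].
  have [c [cc rc qc]] := layout_closed le_a (leqnn (col L f)).
  apply/imsetP; exists c; last by apply: val_inj; rewrite /= !row_ordE rc.
  by rewrite inE /col_key cc qc eqxx rc.
have /dinjectivePn[a aXY [b]] :
    ~~ dinjectiveb (fun a => row_ord (h^-1 a)%g) (mem (X :|: Y)).
  apply/negP=> /dinjectiveP inj; move: lt_card; rewrite ltnNge => /negP[].
  rewrite -(card_in_imset inj); apply: subset_leq_card.
  by apply/subsetP=> _ /imsetP[a aXY ->]; apply: inC.
rewrite inE /= => /andP[ba bXY] /(congr1 val) /=; rewrite !row_ordE => rab.
exists a, b; split=> //; first by rewrite eq_sym.
have compXY (c : 'I_n) : c \in X :|: Y -> comp L (h^-1 c)%g = comp L e.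
  move=> cXY; have [-> _] := hK c.
  by move: cXY; rewrite !inE => /orP[] /andP[/eqP[-> _] _].
by rewrite /row_key rab !compXY.
Qed.

(** The column weight dominates: the multiplier exceeds any possible value of the
    row part, which only serves to break ties. *)
Definition potential (s : 'S_n) : nat :=
  ((\sum_e col L e * s e) * (\sum_e row L e * n).+1 + \sum_e row L e * s e)%N.

Lemma ltn_potential (s s' : 'S_n) :
  (\sum_e col L e * s e < \sum_e col L e * s' e)%N ->
  (potential s < potential s')%N.
Proof.
move=> lt; rewrite /potential; set N := (\sum_e row L e * n).+1.
have lt_N : (\sum_e row L e * s e < N)%N.
  by rewrite ltnS leq_sum // => e _; rewrite leq_mul // ltnW.
have : ((\sum_e col L e * s e).+1 * N <= (\sum_e col L e * s' e) * N)%N.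
  by rewrite leq_mul.
rewrite mulSn => le; apply: leq_trans (leq_trans le (leq_addr _ _)).
by rewrite addnC ltn_add2r.
Qed.

Lemma potential_col_swap (s : 'S_n) (e f : 'I_n) :
  col_key e = col_key f -> (row L e < row L f)%N -> (s f < s e)%N ->
  (potential s < potential (tperm e f * s)%g)%N.
Proof.
move=> kef lt_row lt_s.
have nef : e != f by apply: contraTneq lt_row => ->; rewrite ltnn.
rewrite /potential.
have -> : (\sum_a col L a * (tperm e f * s)%g a = \sum_a col L a * s a)%N.
  rewrite [RHS](reindex_inj (@perm_inj _ (tperm e f))) /=.
  apply: eq_bigr => a _; rewrite permM; congr (_ * _)%N.
  by have /key_stabP/(_ a) := tperm_key_stab kef; case=> _ ->.
have splitD (F : 'I_n -> nat) :
    (\sum_a F a = F e + (F f + \sum_(a | (a != e) && (a != f)) F a))%N.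
  by rewrite (bigD1 e) //= (bigD1 f) // eq_sym.
rewrite ltn_add2l !splitD.
rewrite !permM tpermL tpermR.
rewrite [X in (_ < _ + (_ + X))%N](eq_bigr (fun a => row L a * s a)%N).
  rewrite !addnA ltn_add2r.
  have [k ->] : exists k, row L f = (row L e + k.+1)%N.
    by exists (row L f - (row L e).+1)%N; rewrite addnS -addSn subnKC.
  by rewrite !mulnDl addnCA addnA [X in (_ < X)%N]addnA ltn_add2l ltn_mul2l.
by move=> a /andP[ae af]; rewrite permM tpermD // eq_sym.
Qed.

Lemma potential_garnir (s g : 'S_n) (X Y : {set 'I_n}) (p q : nat) :
  (forall a, a \in X -> col L a = p) -> (forall a, a \in Y -> col L a = q) ->
  (p < q)%N -> perm_on (X :|: Y) g -> g @: X != X ->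
  (forall a b, a \in X -> b \in Y -> (s b < s a)%N) ->
  (potential s < potential (g * s)%g)%N.
Proof.
move=> Xp Yq lt_pq gXY gX lt_s; apply: ltn_potential.
rewrite [X in (_ < X)%N](reindex_inj (@perm_inj _ g^-1%g)) /=.
rewrite [X in (_ < X)%N](eq_bigr (fun a => col L (g^-1 a)%g * s a)%N); last first.
  by move=> a _; rewrite permM permKV.
have gVXY a : ((g^-1)%g a \in X :|: Y) = (a \in X :|: Y).
  by rewrite -{2}(permKV g a) (perm_closed _ gXY).
have gX_XY : g @: X \subset X :|: Y.
  by apply/subsetP=> _ /imsetP[a aX ->]; rewrite (perm_closed _ gXY) inE aX.
have YX : [disjoint X & Y].
  apply/pred0P => a /=; apply/negP=> /andP[aX aY].
  by rewrite -(Xp _ aX) -(Yq _ aY) ltnn in lt_pq.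
have colsum (Z : {set 'I_n}) (w : 'I_n -> nat) : Z \subset X :|: Y ->
    (forall a, a \in Z -> w a = p) ->
    (forall a, a \in (X :|: Y) :\: Z -> w a = q) ->
    (\sum_(a in X :|: Y) w a * s a + (q - p) * \sum_(a in Z) s a
     = q * \sum_(a in X :|: Y) s a)%N.
  move=> sZ wp wq; rewrite (big_setID Z) /= (setIidPr sZ).
  rewrite [X in (_ = q * X)%N](big_setID Z) /= (setIidPr sZ) mulnDr.
  rewrite (eq_bigr (fun a => p * s a)%N) => [|a /wp->//].
  rewrite [X in (_ + X + _)%N](eq_bigr (fun a => q * s a)%N) => [|a /wq->//].
  rewrite -!big_distrr /= addnAC -mulnDl subnKC //; exact: ltnW.
have rest : (\sum_(a | a \notin X :|: Y) col L a * s a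
           = \sum_(a | a \notin X :|: Y) col L (g^-1 a)%g * s a)%N.
  apply: eq_bigr => a aXY; have gV : perm_on (X :|: Y) (g^-1)%g by rewrite perm_onV.
  by rewrite (out_perm gV aXY).
rewrite (bigID (fun a => a \in X :|: Y)) /=.
rewrite [X in (_ < X)%N](bigID (fun a => a \in X :|: Y)) /= -rest ltn_add2r.
have lt : (\sum_(a in g @: X) s a < \sum_(a in X) s a)%N.
  have [] := @leqif_exchange _ (fun a => val (s a)) X (g @: X).
  - by rewrite card_imset //; exact: perm_inj.
  - move=> a b; rewrite !inE => /andP[_ aX] /andP[bX /(subsetP gX_XY)].
    by rewrite inE (negbTE bX) /=; apply: lt_s.
  - by move=> le eqs; rewrite ltn_neqAle eqs le andbT eq_sym.
have E1 := colsum X (fun a => col L a) (subsetUl X Y) Xp.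
have E2 := colsum (g @: X) (fun a => col L (g^-1 a)%g) gX_XY.
have {}E1 : (\sum_(a in X :|: Y) col L a * s a + (q - p) * \sum_(a in X) s a
     = q * \sum_(a in X :|: Y) s a)%N.
  by apply: E1 => a; rewrite !inE => /andP[/negbTE-> /Yq].
have {}E2 : (\sum_(a in X :|: Y) col L ((g^-1)%g a) * s a
     + (q - p) * \sum_(a in g @: X) s a = q * \sum_(a in X :|: Y) s a)%N.
  apply: E2 => a; first by case/imsetP=> b bX ->; rewrite permK; exact: Xp.
  rewrite in_setD -gVXY => /andP[aX]; rewrite inE => /orP[] //; last exact: Yq.
  by move=> gaX; case/imsetP: aX; exists (g^-1 a)%g; rewrite ?permKV.
rewrite -(ltn_add2r ((q - p) * \sum_(a in X) s a)) E1 -E2 ltn_add2l.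
by rewrite ltn_mul2l subn_gt0 lt_pq.
Qed.

End Layout.

(** * Symmetrizing sums and the invariant inner product *)

Section SymmetrizingSums.

Variables (C : numClosedFieldType) (n : nat).
Implicit Types (p q : {mpoly C[n]}) (G H : {group 'S_n}) (g h : 'S_n).

Definition sym_sum (H : {set 'S_n}) p : {mpoly C[n]} := \sum_(h in H) msym h p.

Definition alt_sum (H : {set 'S_n}) p : {mpoly C[n]} :=
  \sum_(h in H) (-1) ^+ odd_perm h *: msym h p.

Fact sym_sum_is_linear (H : {set 'S_n}) : linear (sym_sum H).
Proof.
move=> c p q; rewrite /sym_sum scaler_sumr -big_split /=.
by apply: eq_bigr => h _; rewrite linearP.
Qed.

HB.instance Definition _ (H : {set 'S_n}) :=
  GRing.isLinear.Build C {mpoly C[n]} {mpoly C[n]} *:%R (sym_sum H)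
    (sym_sum_is_linear H).

Fact alt_sum_is_linear (H : {set 'S_n}) : linear (alt_sum H).
Proof.
move=> c p q; rewrite /alt_sum scaler_sumr -big_split /=.
apply: eq_bigr => h _; rewrite linearP scalerDr !scalerA.
by rewrite [c * _]mulrC.
Qed.

HB.instance Definition _ (H : {set 'S_n}) :=
  GRing.isLinear.Build C {mpoly C[n]} {mpoly C[n]} *:%R (alt_sum H)
    (alt_sum_is_linear H).

Lemma sym_sumZ (H : {set 'S_n}) c p : sym_sum H (c *: p) = c *: sym_sum H p.
Proof. by rewrite linearZ. Qed.

Lemma alt_sumZ (H : {set 'S_n}) c p : alt_sum H (c *: p) = c *: alt_sum H p.
Proof. by rewrite linearZ. Qed.

Lemma sym_sum_msym H g p : g \in H -> sym_sum H (msym g p) = sym_sum H p.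
Proof.
move=> gH; rewrite [RHS](reindex_inj (mulgI g)) /=.
by apply: eq_big => [h | h _]; rewrite ?groupMl // msymMm.
Qed.

Lemma msym_sym_sum H g p : g \in H -> msym g (sym_sum H p) = sym_sum H p.
Proof.
move=> gH; rewrite [RHS](reindex_inj (mulIg g)) /= raddf_sum.
by apply: eq_big => [h | h _]; rewrite ?groupMr // msymMm.
Qed.

Lemma alt_sum_msym H g p :
  g \in H -> alt_sum H (msym g p) = (-1) ^+ odd_perm g *: alt_sum H p.
Proof.
move=> gH; rewrite [in RHS]/alt_sum (reindex_inj (mulgI g)) /= scaler_sumr.
apply: eq_big => [h | h _]; first by rewrite groupMl.
by rewrite scalerA odd_permM signr_addb mulrA -expr2 sqrr_sign mul1r msymMm.
Qed.

Lemma msym_alt_sum H g p :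
  g \in H -> msym g (alt_sum H p) = (-1) ^+ odd_perm g *: alt_sum H p.
Proof.
move=> gH; rewrite [in RHS]/alt_sum (reindex_inj (mulIg g)) /= scaler_sumr raddf_sum.
apply: eq_big => [h | h _]; first by rewrite groupMr.
rewrite scalerA odd_permM addbC signr_addb mulrA -expr2 sqrr_sign mul1r.
by rewrite /= msymZ msymMm.
Qed.

Lemma sym_sum_idem H p : sym_sum H (sym_sum H p) = #|H|%:R *: sym_sum H p.
Proof.
rewrite {1}/sym_sum (eq_bigr (fun _ => sym_sum H p)) => [|h hH].
  by rewrite sumr_const scaler_nat.
exact: msym_sym_sum.
Qed.

Lemma alt_sum_idem H p : alt_sum H (alt_sum H p) = #|H|%:R *: alt_sum H p.
Proof.
rewrite {1}/alt_sum (eq_bigr (fun _ => alt_sum H p)) => [|h hH].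
  by rewrite sumr_const scaler_nat.
by rewrite msym_alt_sum // scalerA -expr2 sqrr_sign scale1r.
Qed.

Lemma eq_oppr0 p : p = - p -> p = 0.
Proof.
move=> /eqP; rewrite -subr_eq0 opprK -mulr2n -scaler_nat scaler_eq0.
by rewrite pnatr_eq0 /= => /eqP.
Qed.

Lemma odd_tperm_sign (a b : 'I_n) : a != b -> (-1) ^+ tperm a b = -1 :> C.
Proof. by move=> ab; rewrite odd_tperm ab expr1. Qed.

Lemma msym_tpermC (a b : 'I_n) g p :
  msym g (msym (tperm a b) p) = msym (tperm (g a) (g b)) (msym g p).
Proof. by rewrite -!msymMm -tpermJ /conjg !mulgA mulgV mul1g. Qed.

(** The Hermitian product of the coefficient families, truncated to degree less
    than k so that the sum is finite; k is chosen afterwards, large enough for the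
    polynomial at hand. *)
Definition dotp (k : nat) p q : C := \sum_(m : 'X_{1..n < k}) p@_m * (q@_m)^*.

Lemma dotpDl k p1 p2 q : dotp k (p1 + p2) q = dotp k p1 q + dotp k p2 q.
Proof. by rewrite -big_split; apply: eq_bigr => m _; rewrite mcoeffD mulrDl. Qed.

Lemma dotpZl k c p q : dotp k (c *: p) q = c * dotp k p q.
Proof. by rewrite mulr_sumr; apply: eq_bigr => m _; rewrite mcoeffZ mulrA. Qed.

Lemma dotpDr k p q1 q2 : dotp k p (q1 + q2) = dotp k p q1 + dotp k p q2.
Proof.
by rewrite -big_split; apply: eq_bigr => m _; rewrite mcoeffD rmorphD mulrDr.
Qed.

Lemma dotpZr k c p q : dotp k p (c *: q) = c^* * dotp k p q.
Proof.
by rewrite mulr_sumr; apply: eq_bigr => m _; rewrite mcoeffZ rmorphM mulrCA.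
Qed.

Lemma dotp0l k q : dotp k 0 q = 0.
Proof. by rewrite -(scale0r 0) dotpZl mul0r. Qed.

Lemma dotp0r k p : dotp k p 0 = 0.
Proof. by rewrite -(scale0r 0) dotpZr rmorph0 mul0r. Qed.

Lemma dotp_suml k (I : finType) (P : pred I) (F : I -> {mpoly C[n]}) q :
  dotp k (\sum_(i | P i) F i) q = \sum_(i | P i) dotp k (F i) q.
Proof. by apply: (big_morph (dotp k ^~ q)); [move=> ? ?; exact: dotpDl | exact: dotp0l]. Qed.

Lemma dotp_sumr k (I : finType) (P : pred I) (F : I -> {mpoly C[n]}) p :
  dotp k p (\sum_(i | P i) F i) = \sum_(i | P i) dotp k p (F i).
Proof. by apply: (big_morph (dotp k p)); [move=> ? ?; exact: dotpDr | exact: dotp0r]. Qed.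

Lemma dotp_msym k g p q : dotp k (msym g p) (msym g q) = dotp k p q.
Proof.
pose perm_mnm (m : 'X_{1..n < k}) := [multinom (m : 'X_{1..n}) (g i) | i < n].
have lt_k m : (mdeg (perm_mnm m) < k)%N.
  by rewrite /perm_mnm mdeg_mperm; exact: bmdeg.
pose f m := BMultinom (lt_k m).
have f_inj : injective f.
  by move=> m1 m2 /(congr1 (fun m => bmnm m)) /(@mperm_inj _ g) /val_inj.
rewrite [RHS](reindex_inj f_inj) /=; apply: eq_bigr => m _.
by rewrite !mcoeff_sym.
Qed.

Lemma dotp_msyml k g p q : dotp k (msym g p) q = dotp k p (msym g^-1%g q).
Proof. by rewrite -[q in LHS]msym1m -(mulVg g) msymMm dotp_msym. Qed.

Lemma dotp_sym_sum k H p q : dotp k (sym_sum H p) q = dotp k p (sym_sum H q).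
Proof.
rewrite dotp_suml dotp_sumr [RHS](reindex_inj invg_inj) /=.
by apply: eq_big => [h | h _]; rewrite ?groupV // dotp_msyml.
Qed.

Lemma dotp_alt_sum k H p q : dotp k (alt_sum H p) q = dotp k p (alt_sum H q).
Proof.
rewrite dotp_suml dotp_sumr [RHS](reindex_inj invg_inj) /=.
apply: eq_big => [h | h _]; first by rewrite groupV.
by rewrite dotpZl dotpZr dotp_msyml odd_permV rmorph_sign.
Qed.

Lemma dotp_eq0 k p : (msize p <= k)%N -> dotp k p p = 0 -> p = 0.
Proof.
move=> le_pk /eqP; rewrite psumr_eq0; last first.
  by move=> m _; rewrite -normCK exprn_ge0 ?normr_ge0.
move=> /allP h; rewrite (mpolywE le_pk) big1 // => m _.
have := h m (mem_index_enum _); rewrite /= -normCK expf_eq0 /=.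
by rewrite normr_eq0 => /eqP->; rewrite scale0r.
Qed.

End SymmetrizingSums.

(** * Irreducibility and straightening *)

Section YoungSymmetrizer.

Variables (C : numClosedFieldType) (n r : nat) (L : layout n r).
Implicit Types (p q v F : {mpoly C[n]}) (g h : 'S_n).

Local Notation rho := (@sym_sum C n (row_group L)).
Local Notation kappa := (@alt_sum C n (col_group L)).

(** A transposition within a row that g^-1 carries into a column makes
    rho g kappa equal to its opposite; otherwise both factors of g are absorbed. *)
Lemma row_col_proportional g : g \in comp_group L ->
  exists c : C, forall p, rho (msym g (kappa p)) = c *: rho (kappa p).
Proof.
move=> /(row_col_factorization (L := L)) [[a [b [ab rab cab]]] | [al [be [alR beC ->]]]].
  exists 0 => p; rewrite scale0r; apply: eq_oppr0.
  have tC : tperm a b \in col_group L by apply: tperm_key_stab.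
  have tR : tperm (g a) (g b) \in row_group L by apply: tperm_key_stab.
  have kt : kappa p = - msym (tperm a b) (kappa p).
    by rewrite msym_alt_sum // odd_tperm_sign // scaleN1r opprK.
  by rewrite {1}kt !raddfN /= msym_tpermC sym_sum_msym.
exists ((-1) ^+ odd_perm be) => p.
by rewrite msymMm sym_sum_msym // msym_alt_sum // linearZ.
Qed.

Lemma col_row_proportional g : g \in comp_group L ->
  exists c : C, forall p, kappa (msym g (rho p)) = c *: kappa (rho p).
Proof.
rewrite -groupV => /(row_col_factorization (L := L)).
case=> [[a [b [ab rab cab]]] | [al [be [alR beC gE]]]].
  exists 0 => p; rewrite scale0r; apply: eq_oppr0.
  have tC : tperm a b \in col_group L by apply: tperm_key_stab.
  have tR : tperm (g^-1 a)%g (g^-1 b)%g \in row_group L by apply: tperm_key_stab.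
  rewrite -{1}(msym_sym_sum _ tR) msym_tpermC !permKV alt_sum_msym //.
  by rewrite odd_tperm_sign // scaleN1r.
exists ((-1) ^+ odd_perm be^-1%g) => p.
rewrite -[g]invgK gE invMg msymMm msym_sym_sum ?groupV //.
by rewrite alt_sum_msym ?groupV.
Qed.

Definition orbit_span F v := exists a : 'S_n -> C,
  v = \sum_(g in comp_group L) a g *: msym g F.

(** From a nonzero v in K, some rho (h v) is nonzero, and it is a multiple of
    rho F, where F = kappa (rho x); so rho F lies in K.  Then kappa (rho F) lies in
    K and is a multiple of F.  That multiple is not zero, since the product of
    kappa (rho F) with F is, up to a positive factor, the squared norm of rho F. *)
Lemma young_irreducible (K : {mpoly C[n]} -> Prop) x v :
  (forall c p q, K p -> K q -> K (c *: p + q)) ->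
  (forall g p, g \in comp_group L -> K p -> K (msym g p)) ->
  orbit_span (kappa (rho x)) v -> K v -> v != 0 -> K (kappa (rho x)).
Proof.
move=> Klin Ksym [a vE] Kv v0; set F := kappa (rho x).
have KZ c p : K p -> K (c *: p).
  move=> Kp; have := Klin (-1) _ _ Kp Kp; rewrite scaleN1r addNr => K0.
  by rewrite -[_ *: _]addr0; apply: Klin.
have Ksum (I : finType) (P : pred I) (f : I -> {mpoly C[n]}) :
    (forall i, P i -> K (f i)) -> K (\sum_(i | P i) f i).
  move=> Kf; apply: (big_ind K) => // [|p q Kp Kq].
    by rewrite -(scale0r v); apply: KZ.
  by rewrite -[p]scale1r; apply: Klin.
have Krho p : K p -> K (rho p).
  move=> Kp; apply: Ksum => g gR; apply: Ksym => //.
  exact: (subsetP (row_group_sub L)).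
have Kkappa p : K p -> K (kappa p).
  move=> Kp; apply: Ksum => g gC; apply/KZ/Ksym => //.
  exact: (subsetP (col_group_sub L)).
(* Some translate of v has a nonzero row symmetrization: otherwise v would be
   orthogonal to all the translates of rho x, in particular to itself. *)
have [h hG rv0] : exists2 h, h \in comp_group L & rho (msym h v) != 0.
  apply/exists_inP; apply: contraNT v0; rewrite negb_exists_in => /forall_inP rv.
  apply/eqP/(@dotp_eq0 _ _ (msize v)) => //; rewrite [in X in dotp _ _ X]vE dotp_sumr.
  apply: big1 => g gG; rewrite dotpZr /F /alt_sum raddf_sum dotp_sumr.
  rewrite big1 ?mulr0 // => t tC; rewrite /= msymZ dotpZr -msymMm.
  set u := (t * g)%g; have uG : (u^-1)%g \in comp_group L.
    by rewrite groupV groupM // (subsetP (col_group_sub L)).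
  rewrite -[u]invgK -dotp_msyml -dotp_sym_sum.
  by have := rv _ uG; rewrite negbK => /eqP->; rewrite dotp0l mulr0.
have [c cE] : exists c : C, rho (msym h v) = c *: rho F.
  rewrite vE (raddf_sum (msym h)) (raddf_sum rho) /=.
  apply: (big_ind (fun p => exists c : C, p = c *: rho F)).
  - by exists 0; rewrite scale0r.
  - by move=> _ _ [c ->] [d ->]; exists (c + d); rewrite scalerDl.
  move=> g gG; have [c cP] := row_col_proportional (groupM gG hG).
  by exists (a g * c); rewrite /= msymZ linearZ /= -msymMm cP scalerA.
have c0 : c != 0 by apply: contraNneq rv0 => c0; rewrite cE c0 scale0r.
have KrF : K (rho F).
  by rewrite -[rho F]scale1r -(mulVf c0) -scalerA -cE; apply/KZ/Krho/Ksym.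
have [d dE] : exists d : C, kappa (rho F) = d *: F.
  rewrite {1}/sym_sum (raddf_sum kappa) /=.
  apply: (big_ind (fun p => exists c : C, p = c *: F)).
  - by exists 0; rewrite scale0r.
  - by move=> _ _ [b ->] [d ->]; exists (b + d); rewrite scalerDl.
  move=> g gR; rewrite {1}/F {2}/alt_sum (raddf_sum (msym g)) (raddf_sum kappa) /=.
  apply: (big_ind (fun p => exists c : C, p = c *: kappa (rho x))).
  - by exists 0; rewrite scale0r.
  - by move=> _ _ [b ->] [d ->]; exists (b + d); rewrite scalerDl.
  move=> t tC; have tgG : (t * g)%g \in comp_group L.
    apply: groupM; first exact: (subsetP (col_group_sub L)).
    exact: (subsetP (row_group_sub L)).
  have [d dP] := col_row_proportional tgG.
  exists ((-1) ^+ odd_perm t * d); rewrite msymZ linearZ /= -msymMm.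
  by rewrite dP scalerA.
have d0 : d != 0.
  apply: contraNneq rv0 => d0; rewrite cE.
  rewrite d0 scale0r in dE.
  suff -> : rho F = 0 by rewrite scaler0.
  have card0 (G : {group 'S_n}) : (#|G|%:R : C) != 0.
    by rewrite pnatr_eq0 -lt0n cardG_gt0.
  have : dotp (msize (rho F)) (kappa (rho F)) F = 0 by rewrite dE dotp0l.
  rewrite dotp_alt_sum {2}/F alt_sum_idem -/F dotpZr rmorph_nat => /eqP.
  rewrite mulf_eq0 (negbTE (card0 _)) /= => /eqP rFF.
  apply: (@dotp_eq0 _ _ (msize (rho F))) => //.
  by rewrite -dotp_sym_sum sym_sum_idem dotpZl rFF mulr0.
by rewrite -[F]scale1r -(mulVf d0) -scalerA -dE; apply/KZ/Kkappa.
Qed.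

(** After any column permutation two elements of the union of X and Y lie in a
    common row; their transposition is absorbed by rho and changes the sign of
    the alternating sum. *)
Lemma garnir_relation (e f : 'I_n) x :
  comp L e = comp L f -> row L e = row L f -> (col L e < col L f)%N ->
  let X := [set a | (col_key L a == col_key L e) && (row L e <= row L a)%N] in
  let Y := [set a | (col_key L a == col_key L f) && (row L a <= row L f)%N] in
  alt_sum (Sym_group (X :|: Y)) (kappa (rho x)) = 0.
Proof.
move=> cef ref lt_ef X Y; rewrite {2}/alt_sum (raddf_sum (alt_sum _)) /=.
apply: big1 => h hC; rewrite linearZ /=.
have [a [b [aXY bXY ab rab]]] := garnir_pigeonhole cef ref lt_ef hC.
suff -> : alt_sum (Sym_group (X :|: Y)) (msym h (rho x)) = 0 by rewrite scaler0.
have tR : tperm (h^-1 a)%g (h^-1 b)%g \in row_group L by apply: tperm_key_stab.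
have tXY : tperm a b \in Sym_group (X :|: Y).
  rewrite inE; apply/subsetP=> c; rewrite inE.
  by case: tpermP => [->|->|]; rewrite ?eqxx.
apply: eq_oppr0; rewrite -{1}(msym_sym_sum _ tR) msym_tpermC !permKV.
by rewrite alt_sum_msym // odd_tperm_sign // scaleN1r.
Qed.

(** Standardness of the filling obtained from the given one by applying s to the
    entries. *)
Definition standard_for (s : 'S_n) := forall e f, comp L e = comp L f ->
  (row L e = row L f /\ (col L e < col L f)%N) \/
  (col L e = col L f /\ (row L e < row L f)%N) -> (s e < s f)%N.

(** Induction on the distance of the potential to its maximum.  A descent in a
    column is removed by a transposition, at the cost of a sign.  When the columns
    increase, a descent from e to f in a row makes every entry of X larger than
    every entry of Y; in the Garnir relation the terms that preserve X are all
    equal to the given polynomial, and the other ones have a larger potential. *)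
Lemma straightening (W : {mpoly C[n]} -> Prop) x :
  (forall c p q, W p -> W q -> W (c *: p + q)) -> W 0 ->
  (forall s, s \in comp_group L -> standard_for s -> W (msym s (kappa (rho x)))) ->
  forall s, s \in comp_group L -> W (msym s (kappa (rho x))).
Proof.
move=> Wlin W0 Wstd s; set F := kappa (rho x).
have WZ c p : W p -> W (c *: p) by move=> Wp; rewrite -[_ *: _]addr0; apply: Wlin.
have [m] := ubnP ((\max_(g : 'S_n) potential L g) - potential L s)%N.
elim: m s => // m IHm s lt_m sG.
have IH g : g \in comp_group L -> (potential L s < potential L g)%N ->
    W (msym g F).
  move=> gG lt_sg; apply: IHm => //; apply: leq_trans (ltnSE lt_m).
  by rewrite ltn_sub2l // (leq_trans lt_sg) // (leq_bigmax g).
have [/existsP[e /existsP[f /and3P[/eqP kef ref sef]]] | nocol] :=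
  boolP [exists e, exists f, [&& col_key L e == col_key L f,
           (row L e < row L f)%N & (s f < s e)%N]].
  have tC : tperm e f \in col_group L by apply: tperm_key_stab.
  have ef : e != f by apply: contraTneq ref => ->; rewrite ltnn.
  have -> : msym s F = -1 *: msym (tperm e f * s)%g F.
    rewrite msymMm /F (msym_alt_sum _ tC) odd_tperm_sign // msymZ.
    by rewrite !scaleN1r opprK.
  apply/WZ/IH; last exact: potential_col_swap.
  by rewrite groupM // (subsetP (col_group_sub L)).
have incr e f : col_key L e = col_key L f -> (row L e < row L f)%N -> (s e < s f)%N.
  move=> kef ref; rewrite ltn_neqAle; apply/andP; split.
    by apply: contraTneq ref => /val_inj/perm_inj->; rewrite ltnn.
  rewrite leqNgt; apply: contra nocol => sef.
  by apply/existsP; exists e; apply/existsP; exists f; rewrite kef eqxx ref.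
have incr_le e f : col_key L e = col_key L f -> (row L e <= row L f)%N ->
    (s e <= s f)%N.
  move=> kef; rewrite leq_eqVlt => /orP[/eqP ref | /incr /ltnW->//].
  by case: kef => cef qef; rewrite (layout_inj cef ref qef).
have [/existsP[e /existsP[f /and4P[/eqP cef /eqP ref qef sef]]] | norow] :=
  boolP [exists e, exists f, [&& comp L e == comp L f, row L e == row L f,
           (col L e < col L f)%N & (s f < s e)%N]]; last first.
  apply: Wstd => // e f cef [] [rc lt].
    rewrite ltn_neqAle; apply/andP; split.
      by apply: contraTneq lt => /val_inj/perm_inj->; rewrite ltnn.
    rewrite leqNgt; apply: contra norow => sef.
    by apply/existsP; exists e; apply/existsP; exists f; rewrite cef rc !eqxx lt.
  by apply: incr => //; rewrite /col_key cef rc.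
pose X := [set a | (col_key L a == col_key L e) && (row L e <= row L a)%N].
pose Y := [set a | (col_key L a == col_key L f) && (row L a <= row L f)%N].
have XP a : a \in X -> col_key L a = col_key L e by rewrite inE => /andP[/eqP].
have YP a : a \in Y -> col_key L a = col_key L f by rewrite inE => /andP[/eqP].
have YX a : a \in Y -> a \notin X.
  move=> aY; apply/negP=> aX; have [_ qa] := YP _ aY; have [_ qa'] := XP _ aX.
  by move: qef; rewrite -qa qa' ltnn.
have XYcomp a : a \in X :|: Y -> comp L a = comp L e.
  by rewrite inE => /orP[/XP[]// | /YP[-> _]].
have XY_G g : perm_on (X :|: Y) g -> g \in comp_group L.
  move=> gXY; apply/key_stabP => a; have [aXY | aXY] := boolP (a \in X :|: Y).
    by rewrite !XYcomp // (perm_closed _ gXY).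
  by rewrite (out_perm gXY aXY).
have stab_C g : perm_on (X :|: Y) g -> g @: X == X -> g \in col_group L.
  move=> gXY /eqP gX; apply/key_stabP => a.
  have gaX : (g a \in X) = (a \in X).
    by rewrite -{1}gX mem_imset //; exact: perm_inj.
  have [aXY | aXY] := boolP (a \in X :|: Y); last by rewrite (out_perm gXY aXY).
  have := aXY; rewrite -(perm_closed _ gXY) in_setU gaX.
  move: aXY; rewrite in_setU => /orP[aX _ | aY].
    by rewrite (XP _ aX) XP // gaX.
  by rewrite (negbTE (YX _ aY)) /= => /YP->; rewrite (YP a aY).
have := congr1 (msym s) (garnir_relation x cef ref qef); rewrite -/X -/Y.
rewrite -/F msym0 {1}/alt_sum (raddf_sum (msym s)) /=.
rewrite (bigID (fun g : 'S_n => g @: X == X)) /= => rel.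
(* The number of terms that preserve X, positive because of the identity. *)
pose N := #|[pred g | (g \in Sym (X :|: Y)) && (g @: X == X)]|.
have N0 : (N%:R : C) != 0.
  rewrite pnatr_eq0 -lt0n; apply/card_gt0P; exists 1%g.
  rewrite inE /= group1 /=; apply/eqP/setP=> a; apply/imsetP/idP.
    by case=> b bX ->; rewrite perm1.
  by exists a; rewrite ?perm1.
move: rel; rewrite (eq_bigr (fun _ => msym s F)); last first.
  move=> g /andP[]; rewrite inE => gXY gX; rewrite /F.
  by rewrite (msym_alt_sum _ (stab_C _ gXY gX)) scalerA -expr2 sqrr_sign scale1r.
rewrite sumr_const -/N -scaler_nat => /eqP; rewrite addr_eq0 => /eqP rel.
rewrite -[msym s F]scale1r -(mulVf N0) -scalerA rel -scaleN1r; apply/WZ/WZ.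
apply: big_ind => //.
  by move=> p q Wp Wq; rewrite -[p]scale1r; apply: Wlin.
move=> g /andP[]; rewrite inE => gXY gX; rewrite msymZ -msymMm; apply/WZ/IH.
  exact: groupM (XY_G _ gXY) sG.
apply: (potential_garnir (X := X) (Y := Y) (p := col L e) (q := col L f)) => //.
- by move=> a aX; have [] := XP a aX.
- by move=> a aY; have [] := YP a aY.
move=> a b; rewrite !inE => /andP[/eqP ka ra] /andP[/eqP kb rb].
apply: leq_ltn_trans (incr_le _ _ kb rb) (leq_trans sef _).
exact: incr_le.
Qed.

End YoungSymmetrizer.

(** * The permutation action on rational functions *)

Lemma young_subgroupP (r : nat) (ns : 'I_r -> nat) (s : 'S_(ntot ns)) :
  reflect (forall i a, (s a \in block ns i) = (a \in block ns i))
          (s \in young_subgroup ns).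
Proof.
rewrite inE; apply: (iffP forallP) => [h i a | h i].
  by rewrite -{1}(eqP (h i)) mem_imset //; exact: perm_inj.
rewrite eqEcard card_imset ?leqnn ?andbT; last exact: perm_inj.
by apply/subsetP=> _ /imsetP[a aB ->]; rewrite h.
Qed.

Lemma young_astabs (r : nat) (ns : 'I_r -> nat) (s : 'S_(ntot ns)) i :
  s \in young_subgroup ns -> s \in 'N(block ns i | 'P)%g.
Proof. by move=> /young_subgroupP sG; apply/astabsP => a; exact: sG. Qed.

Lemma young_subgroupV (r : nat) (ns : 'I_r -> nat) (s : 'S_(ntot ns)) :
  s \in young_subgroup ns -> (s^-1)%g \in young_subgroup ns.
Proof.
by move=> /young_subgroupP h; apply/young_subgroupP => i a; rewrite -h permKV.
Qed.

Lemma msymXU (C : nzRingType) (n : nat) (s : 'S_n) (k : 'I_n) :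
  msym s 'X_k = 'X_(s k) :> {mpoly C[n]}.
Proof. by rewrite /msym mmapX mmap1U. Qed.

(** Any injective ring endomorphism extends to fractions.  The extension is studied
    over an arbitrary domain; [act s] is convertible to the instance for
    [msym s]. *)
Section FractionMap.

Variables (A : idomainType) (h : {rmorphism A -> A}).
Hypothesis h_inj : injective h.
Implicit Types f g : {fraction A}.

Definition frac_map f : {fraction A} :=
  tofrac (h (\n_(repr f))) / tofrac (h (\d_(repr f))).

Lemma frac_mapE p q : q != 0 ->
  frac_map (tofrac p / tofrac q) = tofrac (h p) / tofrac (h q).
Proof. exact: frac_map_rep h_inj (rmorph0 h) (rmorphM h). Qed.

Lemma frac_ex f : exists p q, q != 0 /\ f = tofrac p / tofrac q.
Proof.
exists (\n_(repr f)), (\d_(repr f)); split; first exact: denom_ratioP.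
by rewrite fracE.
Qed.

Lemma frac_map_neq0 p : p != 0 -> h p != 0.
Proof. by apply: contraNneq => hp; apply/eqP/h_inj; rewrite hp rmorph0. Qed.

Lemma frac_mapB f g : frac_map (f - g) = frac_map f - frac_map g.
Proof.
have [p [q [q0 ->]]] := frac_ex f; have [p' [q' [q'0 ->]]] := frac_ex g.
have nz u : u != 0 -> tofrac u != 0 :> {fraction A} by rewrite tofrac_eq0.
rewrite -mulNr addf_div ?nz // -tofracN -!tofracM -tofracD !frac_mapE ?mulf_neq0 //.
rewrite -[in RHS]mulNr addf_div ?nz ?frac_map_neq0 //.
by rewrite -!tofracN -!tofracM -tofracD -!rmorphN -!rmorphM -rmorphD.
Qed.

Lemma frac_mapM f g : frac_map (f * g) = frac_map f * frac_map g.
Proof.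
have [p [q [q0 ->]]] := frac_ex f; have [p' [q' [q'0 ->]]] := frac_ex g.
have -> : tofrac p / tofrac q * (tofrac p' / tofrac q')
    = tofrac (p * p') / tofrac (q * q') by rewrite mulf_div -!tofracM.
by rewrite !frac_mapE ?mulf_neq0 // mulf_div -!tofracM -!rmorphM.
Qed.

Lemma frac_map_tofrac p : frac_map (tofrac p) = tofrac (h p).
Proof.
have := frac_mapE p (oner_neq0 A).
by rewrite (rmorph1 h) !tofrac1 !divr1.
Qed.

End FractionMap.

Lemma frac_mapK (A : idomainType) (h k : {rmorphism A -> A}) :
  cancel h k -> cancel k h -> cancel (frac_map h) (frac_map k).
Proof.
move=> hK kK f; have [p [q [q0 ->]]] := frac_ex f.
have [h_inj k_inj] := (can_inj hK, can_inj kK).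
by rewrite (frac_mapE h_inj) // (frac_mapE k_inj) ?frac_map_neq0 // !hK.
Qed.

Section Act.

Variables (R : realType) (n : nat).
Implicit Types (p q : {mpoly R[i][n]}) (f g : ratfun R n) (s : 'S_n).

Fact act_is_zmod_morphism s : zmod_morphism (@act R n s).
Proof. by move=> f g; apply: frac_mapB (@inj_msym _ _ s) f g. Qed.

HB.instance Definition _ s :=
  GRing.isZmodMorphism.Build (ratfun R n) (ratfun R n) (@act R n s)
    (act_is_zmod_morphism s).

Lemma act_tofrac s p : act s (tofrac p) = tofrac (msym s p).
Proof. exact: frac_map_tofrac (@inj_msym _ _ s) p. Qed.

Fact act_is_monoid_morphism s : monoid_morphism (@act R n s).
Proof.
split; first by rewrite -tofrac1 act_tofrac msym1.
by move=> f g; apply: frac_mapM (@inj_msym _ _ s) f g.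
Qed.

HB.instance Definition _ s :=
  GRing.isMonoidMorphism.Build (ratfun R n) (ratfun R n) (@act R n s)
    (act_is_monoid_morphism s).

Lemma actD s : {morph @act R n s : f g / f + g}.
Proof. exact: (rmorphD (@act R n s)). Qed.

Lemma actM s : {morph @act R n s : f g / f * g}.
Proof. exact: (rmorphM (@act R n s)). Qed.

Lemma actV s : {morph @act R n s : f / f^-1}.
Proof. exact: (fmorphV (@act R n s)). Qed.

Lemma act_cst s (c : R[i]) : act s (cst n c) = cst n c.
Proof. by rewrite /cst act_tofrac -[c%:MP]mulr1 mul_mpolyC msymZ msym1. Qed.

Lemma actVK s f : act s (act s^-1%g f) = f.
Proof.
have K (g : 'S_n) : cancel (@msym n R[i] g^-1%g) (msym g).
  by move=> u; rewrite -msymMm mulVg msym1m.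
have K' : cancel (@msym n R[i] s) (msym s^-1%g).
  by move=> u; rewrite -msymMm mulgV msym1m.
exact: (frac_mapK (K s) K') f.
Qed.

Lemma actK s f : act s^-1%g (act s f) = f.
Proof. by rewrite -{2}[s]invgK actVK. Qed.

Lemma tofracZ (c : R[i]) p : tofrac (c *: p) = cst n c * tofrac p.
Proof. by rewrite -mul_mpolyC tofracM. Qed.

End Act.

(** * Derivations of O_U and equivariance of the operators *)

Section OU.

Variables (R : realType) (r : nat) (ns : 'I_r -> nat).
Hypothesis cover : forall k : 'I_(ntot ns), exists i, k \in block ns i.

Local Notation n := (ntot ns).
Local Notation OU := (@in_OU R r ns).
Implicit Types (p q : {mpoly R[i][n]}) (f g : ratfun R n) (s : 'S_n).

Lemma subX_neq0 (k l : 'I_n) : k != l -> 'X_k - 'X_l != 0 :> {mpoly R[i][n]}.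
Proof.
move=> kl; apply/eqP => /(congr1 (mcoeff U_(k))).
rewrite mcoeffB !mcoeffXU eqxx eq_sym (negbTE kl) subr0 mcoeff0 => /eqP.
by rewrite oner_eq0.
Qed.

Lemma vdm_neq0 : vdm R ns != 0.
Proof.
apply/prodf_neq0 => i _; apply/prodf_neq0 => k _; apply/prodf_neq0 => l /andP[_ kl].
by apply: subX_neq0; rewrite -val_eqE neq_ltn kl.
Qed.

(** In each block, the square of the Vandermonde product is, up to a sign that does
    not depend on s, the product of x_k - x_l over all the ordered pairs of
    distinct indices, which is visibly invariant. *)
Lemma msym_vdm2 s : s \in young_subgroup ns -> msym s (vdm R ns ^+ 2) = vdm R ns ^+ 2.
Proof.
move=> /young_subgroupP sG; rewrite /vdm -prodrXl rmorph_prod; apply: eq_bigr => i _.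
set B := block ns i; set V := \prod_(k in B) _.
pose c : {mpoly R[i][n]} := \prod_(k in B) \prod_(l in B | (k < l)%N) (-1).
have c2 : c * c = 1.
  rewrite -big_split big1 // => k _; rewrite -big_split big1 // => l _.
  by rewrite /= mulrNN mulr1.
(* The factors with l < k are regrouped as those with k < l, up to the sign c. *)
have VE : \prod_(k in B) \prod_(l in B | l != k) ('X_k - 'X_l) = c * (V * V).
  transitivity (\prod_(k in B) (\prod_(l in B | (k < l)%N) ('X_k - 'X_l)
      * \prod_(l in B | (l < k)%N) ('X_k - 'X_l)) : {mpoly R[i][n]}).
    apply: eq_bigr => k _; rewrite (bigID (fun l : 'I_n => (k < l)%N)) /=.
    congr (_ * _); apply: eq_bigl => l; rewrite -andbA -val_eqE /=;
      by case: (ltngtP l k); rewrite ?andbF ?andbT.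
  rewrite big_split /= -/V [RHS]mulrCA; congr (_ * _).
  rewrite -[RHS]big_split /=.
  rewrite (exchange_big_dep (fun l => l \in B)) //=; last by move=> k l _ /andP[].
  apply: eq_bigr => l lB; rewrite -big_split /=.
  apply: eq_big => [k|k _]; first by rewrite lB.
  by rewrite mulN1r opprB.
have -> : V ^+ 2 = c * \prod_(k in B) \prod_(l in B | l != k) ('X_k - 'X_l).
  by rewrite VE mulrA c2 mul1r.
have msym_c : msym s c = c.
  rewrite rmorph_prod; apply: eq_bigr => k _.
  by rewrite rmorph_prod; apply: eq_bigr => l _; rewrite rmorphN1.
rewrite rmorphM /= msym_c; congr (_ * _).
rewrite [RHS](reindex_inj (@perm_inj _ s)) rmorph_prod /=.
apply: eq_big => [k|k kB]; first by rewrite sG.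
rewrite [RHS](reindex_inj (@perm_inj _ s)) rmorph_prod /=.
apply: eq_big => [l|l lB]; first by rewrite sG (inj_eq perm_inj).
by rewrite rmorphB /= !msymXU.
Qed.


Lemma OU_tofrac p : OU (tofrac p).
Proof. by exists p, 0; rewrite expr0 divr1. Qed.

Lemma tofrac_vdm_neq0 k : tofrac (vdm R ns) ^+ k != 0 :> ratfun R n.
Proof. by rewrite expf_neq0 // tofrac_eq0 vdm_neq0. Qed.

Lemma OU_add f g : OU f -> OU g -> OU (f + g).
Proof.
move=> [p [k ->]] [q [l ->]].
exists (p * vdm R ns ^+ l + q * vdm R ns ^+ k), (k + l)%N.
by rewrite addf_div ?tofrac_vdm_neq0 // exprD tofracD !tofracM !tofracXn.
Qed.

Lemma OU_mul f g : OU f -> OU g -> OU (f * g).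
Proof.
move=> [p [k ->]] [q [l ->]]; exists (p * q), (k + l)%N.
by rewrite mulf_div exprD tofracM.
Qed.

Lemma OU_cst c : OU (cst n c).
Proof. exact: OU_tofrac. Qed.

Lemma OU_act s f : s \in young_subgroup ns -> OU f -> OU (act s f).
Proof.
move=> sG [p [k ->]]; exists (msym s (p * vdm R ns ^+ k)), (2 * k)%N.
have -> : tofrac p / tofrac (vdm R ns) ^+ k
    = tofrac (p * vdm R ns ^+ k) / tofrac ((vdm R ns ^+ 2) ^+ k).
  rewrite tofracM !tofracXn -exprM mulnC exprM -[_ ^+ k ^+ 2]/(_ * _) invfM mulrA.
  by rewrite mulfK ?tofrac_vdm_neq0.
rewrite actM actV !act_tofrac (rmorphXn (msym s)) /= msym_vdm2 //.
by rewrite !tofracXn exprM.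
Qed.

Lemma derivation_cst (d : ratfun R n -> ratfun R n) c :
  is_derivation_OU d -> d (cst n c) = 0.
Proof.
move=> [dO dl dM].
have O1 : OU 1 by rewrite -tofrac1; apply: OU_tofrac.
have O0 : OU 0 by rewrite -tofrac0; apply: OU_tofrac.
have selfD (u : ratfun R n) : u = u + u -> u = 0.
  by move=> h; apply: (@addrI _ u); rewrite -h addr0.
have d0 : d 0 = 0.
  by have := dl 1 0 0 O0 O0; rewrite /cst tofrac1 !mul1r addr0 => /selfD.
have d1 : d 1 = 0.
  by have := dM 1 1 O1 O1; rewrite !mul1r mulr1 => /selfD.
by have := dl c 1 0 O1 O0; rewrite mulr1 addr0 d0 d1 mulr0 addr0.
Qed.

Lemma only_varsM (B : {set 'I_n}) p q :
  only_vars B p -> only_vars B q -> only_vars B (p * q).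
Proof.
move=> hp hq m /msuppM_le /allpairsP[[m1 m2] /= [/hp h1 /hq h2 ->]] k kB.
by rewrite mnmDE h1 // h2.
Qed.

Lemma only_varsD (B : {set 'I_n}) p q :
  only_vars B p -> only_vars B q -> only_vars B (p + q).
Proof.
by move=> hp hq m /msuppD_le; rewrite mem_cat => /orP[/hp | /hq].
Qed.

Lemma only_vars0 (B : {set 'I_n}) : only_vars B (0 : {mpoly R[i][n]}).
Proof. by move=> m; rewrite msupp0. Qed.

Lemma only_varsC (B : {set 'I_n}) (c : R[i]) : only_vars B (c%:MP).
Proof.
move=> m; rewrite msuppC; case: eqP => // _; rewrite inE => /eqP-> k _.
by rewrite mnm0E.
Qed.

Lemma only_varsX (B : {set 'I_n}) l : l \in B -> only_vars B ('X_l : {mpoly R[i][n]}).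
Proof.
move=> lB m; rewrite msuppX inE => /eqP-> k kB; rewrite mnm1E.
by case: eqP kB => // <-; rewrite lB.
Qed.

Definition block_poly (i : 'I_r) : {poly {mpoly R[i][n]}} :=
  \prod_(l in block ns i) ('X - ('X_l)%:P).

Lemma block_poly_invariant i j : block_invariant i (block_poly i)`_j.
Proof.
split.
  move: j; rewrite /block_poly.
  apply: (big_ind (fun u : {poly _} => forall j, only_vars (block ns i) u`_j)).
  - by move=> j; rewrite coef1 -mpolyC_nat; apply: only_varsC.
  - move=> u v hu hv j; rewrite coefM; apply: (big_ind (only_vars _)) => [|p q|k _].
    + exact: only_vars0.
    + exact: only_varsD.
    + exact: only_varsM.
  move=> l lB j; rewrite coefB coefX coefC; apply: only_varsD.
    by rewrite -mpolyC_nat; apply: only_varsC.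
  rewrite -mulN1r; apply: only_varsM; first by rewrite -mpolyCN; exact: only_varsC.
  by case: (j == 0)%N; [exact: only_varsX | exact: only_vars0].
move=> s sB.
have E : map_poly (msym s) (block_poly i) = block_poly i.
  rewrite /block_poly map_prod_XsubC [RHS](reindex_inj (@perm_inj _ s)) /=.
  by apply: eq_big => [l | l _]; rewrite ?(perm_closed _ sB) ?msymXU.
by rewrite -[in RHS]E coef_map.
Qed.

(** The chain rule for polynomials whose coefficients are killed by d. *)
Lemma derivation_horner (d : ratfun R n -> ratfun R n) (u : {poly {mpoly R[i][n]}}) p :
  is_derivation_OU d -> (forall j, d (tofrac u`_j) = 0) ->
  d (tofrac u.[p]) = tofrac u^`().[p] * d (tofrac p).
Proof.
move=> der; have [_ dl dM] := der; elim/poly_ind: u => [_|u c IH du].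
  rewrite horner0 deriv0 horner0 tofrac0 mul0r.
  by have := derivation_cst 0 der; rewrite /cst mpolyC0 tofrac0.
have du' j : d (tofrac u`_j) = 0.
  by have := du j.+1; rewrite coefD coefMX coefC addr0.
have dc : d (tofrac c) = 0.
  by have := du 0; rewrite coefD coefMX coefC add0r.
rewrite derivD derivC addr0 derivM derivX mulr1 !hornerE.
have := dl 1 _ _ (OU_tofrac (u.[p] * p)) (OU_tofrac c).
rewrite /cst mpolyC1 tofrac1 !mul1r tofracD => ->.
rewrite dc addr0 tofracM dM ?IH //; try exact: OU_tofrac.
by rewrite tofracD tofracM mulrDl mulrAC.
Qed.

(** Evaluating the block polynomial B at its root x_k gives
    0 = d (B(x_k)) = B'(x_k) d(x_k), and B'(x_k) is a product of differences of
    distinct variables, hence nonzero.  The Leibniz rule does the rest. *)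
Lemma derivation_eq0 (d : ratfun R n -> ratfun R n) :
  is_derivation_OU d ->
  (forall i p, block_invariant i p -> d (tofrac p) = 0) ->
  forall f, OU f -> d f = 0.
Proof.
move=> der d_inv; have [_ dl dM] := der.
have dX k : d (tofrac 'X_k) = 0.
  have [i kB] := cover k.
  have rt : (block_poly i).[ 'X_k] = 0.
    by rewrite /block_poly (bigD1 k) //= hornerM hornerXsubC subrr mul0r.
  have rt' : (block_poly i)^`().[ 'X_k] != 0.
    rewrite /block_poly (bigD1 k) //= derivM derivXsubC mul1r hornerD hornerM.
    rewrite hornerXsubC subrr mul0r addr0 horner_prod.
    apply/prodf_neq0 => l /andP[_ lk]; rewrite hornerXsubC.
    by apply: subX_neq0; rewrite eq_sym.
  have := derivation_horner 'X_k der (fun j => d_inv _ _ (block_poly_invariant i j)).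
  rewrite rt -/(cst n 0) derivation_cst // => /esym/eqP.
  by rewrite mulf_eq0 tofrac_eq0 (negbTE rt') => /eqP.
have d1 : d (tofrac 1) = 0 by rewrite -[1]/(1%:MP) -/(cst n 1) derivation_cst.
have dmul p q : d (tofrac p) = 0 -> d (tofrac q) = 0 -> d (tofrac (p * q)) = 0.
  move=> dp dq; rewrite tofracM dM ?dp ?dq ?mulr0 ?mul0r ?addr0 //;
    exact: OU_tofrac.
have dexp p k : d (tofrac p) = 0 -> d (tofrac (p ^+ k)) = 0.
  by move=> dp; elim: k => [|k IH]; rewrite ?expr0 // exprS dmul.
have dpoly p : d (tofrac p) = 0.
  elim/mpolyind: p => [|c m p _ _ IH].
    by rewrite -mpolyC0 -/(cst n 0) derivation_cst.
  rewrite tofracD tofracZ dl ?IH ?addr0; try exact: OU_tofrac.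
  rewrite mpolyXE_id.
  suff -> : d (tofrac (\prod_(i < n) 'X_i ^+ m i)) = 0 by rewrite mulr0.
  by apply: (big_ind (fun p => d (tofrac p) = 0)) => // i _; apply: dexp.
move=> f [p [k fE]]; have vk := tofrac_vdm_neq0 k.
have := dpoly p; have -> : tofrac p = f * tofrac (vdm R ns ^+ k).
  by rewrite fE tofracXn mulfVK.
rewrite dM; [| by exists p, k | exact: OU_tofrac].
by rewrite dpoly mulr0 addr0 => /eqP; rewrite mulf_eq0 tofracXn (negbTE vk) orbF => /eqP.
Qed.

Lemma msym_only_vars (B : {set 'I_n}) p (s t : 'S_n) :
  only_vars B p -> {in B, s =1 t} -> msym s p = msym t p.
Proof.
move=> pB st; rewrite /msym /mmap; apply: eq_big_seq => m mp; congr (_ * _).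
apply: eq_bigr => k _; have [kB | kB] := boolP (k \in B); first by rewrite st.
by rewrite (pB m mp k kB) !expr0.
Qed.

(** Block invariance only speaks of permutations supported by the block; an
    element of the Young subgroup agrees with one of those on the block. *)
Lemma msym_block_invariant i p s :
  s \in young_subgroup ns -> block_invariant i p -> msym s p = p.
Proof.
move=> sG [pB p_inv]; rewrite -[RHS](p_inv _ (restr_perm_on (block ns i) s)).
apply: (msym_only_vars pB) => k kB.
by rewrite restr_permE // young_astabs.
Qed.

Section Operators.

Variables (y : n.-tuple {mpoly R[i][n]}) (hy : invariant_coords y).
Variable dy : 'I_n -> ratfun R n -> ratfun R n.
Hypothesis hdy : forall j, is_ddy y j (dy j).

Lemma msym_coord s j : s \in young_subgroup ns -> msym s (tnth y j) = tnth y j.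
Proof.
move=> sG; have [i ji] := cover j; have [h _ _] := hy i.
exact: (msym_block_invariant sG (h j ji)).
Qed.

Lemma msym_comp_coords s q : s \in young_subgroup ns -> msym s (q \mPo y) = q \mPo y.
Proof.
move=> sG; rewrite comp_mpolyE (raddf_sum (msym s)); apply: eq_bigr => m _.
rewrite /= msymZ (rmorph_prod (msym s)) /=; congr (_ *: _); apply: eq_bigr => j _.
by rewrite (rmorphXn (msym s)) /= msym_coord.
Qed.

Lemma act_derivation s (d : ratfun R n -> ratfun R n) :
  s \in young_subgroup ns -> is_derivation_OU d ->
  is_derivation_OU (fun f => act s (d (act s^-1%g f))).
Proof.
move=> sG [dO dl dM]; have sVG := young_subgroupV sG.
have sVO f : OU f -> OU (act s^-1%g f) by apply: OU_act.
split=> [f fO | c f g fO gO | f g fO gO]; first exact/OU_act/dO/sVO.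
  rewrite actD actM act_cst dl; try exact: sVO.
  by rewrite actD actM act_cst.
rewrite actM dM; try exact: sVO.
rewrite actD (actM s _ (act s^-1%g g)) (actM s (act s^-1%g f)).
by congr (_ * _ + _ * _); apply: actVK.
Qed.

Lemma derivationB (d1 d2 : ratfun R n -> ratfun R n) :
  is_derivation_OU d1 -> is_derivation_OU d2 ->
  is_derivation_OU (fun f => d1 f - d2 f).
Proof.
move=> [dO1 dl1 dM1] [dO2 dl2 dM2].
split=> [f fO | c f g fO gO | f g fO gO].
- rewrite -mulN1r; apply: OU_add; first exact: dO1.
  apply: OU_mul; last exact: dO2.
  by rewrite -tofrac1 -tofracN; apply: OU_tofrac.
- by rewrite dl1 // dl2 // mulrBr opprD addrACA.
by rewrite dM1 // dM2 // mulrBl mulrBr opprD addrACA.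
Qed.

(** The difference of d/dy_j and of its conjugate by s is a derivation killing all
    the block invariants. *)
Lemma dy_act s j f : s \in young_subgroup ns -> OU f ->
  dy j (act s f) = act s (dy j f).
Proof.
move=> sG fO; have [der djy] := hdy j.
have der' := derivationB der (act_derivation sG der).
have sf : OU (act s f) by apply: OU_act.
have inv0 i p : block_invariant i p ->
    dy j (tofrac p) - act s (dy j (act s^-1%g (tofrac p))) = 0.
  move=> p_inv; have [_ h _] := hy i; have [q _ ->] := h p p_inv.
  rewrite act_tofrac (msym_comp_coords _ (young_subgroupV sG)) djy act_tofrac.
  by rewrite (msym_comp_coords _ sG) subrr.
have := derivation_eq0 der' inv0 sf; rewrite actK => /eqP.
by rewrite subr_eq0 => /eqP.
Qed.

(** Linearity and equivariance are only claimed on O_U, where the operators are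
    meaningful, so stability of O_U has to be carried along in the induction on
    the operator. *)
Lemma DV_equivariant D : in_DV y dy D ->
  [/\ forall f, OU f -> OU (D f),
      forall c f g, OU f -> OU g -> D (cst n c * f + g) = cst n c * D f + D g
    & forall s f, s \in young_subgroup ns -> OU f -> D (act s f) = act s (D f)].
Proof.
elim=> {D} [c | j | j | | D1 D2 _ [O1 l1 e1] _ [O2 l2 e2]
           | D1 D2 _ [O1 l1 e1] _ [O2 l2 e2]].
- split=> [f fO | d f g _ _ | s f _ _].
  + by apply: OU_mul => //; apply: OU_cst.
  + by rewrite mulrDr mulrCA.
  by rewrite actM act_cst.
- split=> [f fO | d f g _ _ | s f sG _].
  + by apply: OU_mul => //; apply: OU_tofrac.
  + by rewrite mulrDr mulrCA.
  by rewrite actM act_tofrac msym_coord.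
- have [[dO dl dM] _] := hdy j; split=> // s f sG fO; exact: dy_act.
- split=> [f fO | d f g _ _ | s f sG _].
  + apply: OU_mul => //; exists 1, 2; by rewrite tofrac1 mul1r.
  + by rewrite mulrDr mulrCA.
  rewrite actM actV -tofracXn act_tofrac msym_vdm2 //.
- split=> [f fO | d f g fO gO | s f sG fO].
  + by apply: OU_add; [apply: O1 | apply: O2].
  + by rewrite l1 // l2 // mulrDr addrACA.
  by rewrite e1 // e2 // actD.
split=> [f fO | d f g fO gO | s f sG fO].
- exact/O1/O2.
- by rewrite l2 // l1 //; apply: O2.
by rewrite e2 // e1 //; apply: O2.
Qed.


End Operators.

End OU.

(** * Splitting the symmetrizer along the blocks *)

(** A sum over a set of products h k in which k, hence h, can be recovered from
    the product; [rem] is that recovery map. *)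
Lemma big_mul_split (V : nmodType) (gT : finGroupType) (M H K : {set gT})
    (rem : gT -> gT) (F : gT -> V) :
  (forall h k, h \in H -> k \in K -> (h * k)%g \in M /\ rem (h * k)%g = k) ->
  (forall u, u \in M -> rem u \in K /\ (u * (rem u)^-1)%g \in H) ->
  \sum_(u in M) F u = \sum_(h in H) \sum_(k in K) F (h * k)%g.
Proof.
move=> HK_M M_HK; rewrite pair_big_dep /=.
rewrite (reindex_onto (fun p : gT * gT => p.1 * p.2)%g
           (fun u => (u * (rem u)^-1, rem u))%g) /=; last by move=> u _; rewrite mulgKV.
apply: eq_bigl => -[h k] /=; apply/andP/andP => [[hkM /eqP[hE kE]] | [hH kK]].
  by have := M_HK _ hkM; rewrite hE kE => -[].
have [-> ->] := HK_M h k hH kK; split=> //.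
by rewrite mulgK.
Qed.

Section PartialStabilizers.

Variables (n r : nat) (L : layout n r) (KT : eqType) (key : 'I_n -> KT).
Hypothesis key_comp : forall a b, key a = key b -> comp L a = comp L b.

(** The part of a row or column group that moves only the components listed in s:
    a single component gives the group of one diagram, and all of them give the
    whole group. *)
Definition stab_on (s : seq 'I_r) : {set 'S_n} :=
  [set g in key_stab key | [forall a, (comp L a \notin s) ==> (g a == a)]].

Lemma stab_onP (s : seq 'I_r) (g : 'S_n) :
  reflect ((forall a, key (g a) = key a) /\ (forall a, comp L a \notin s -> g a = a))
          (g \in stab_on s).
Proof.
rewrite inE; apply: (iffP andP) => [[/key_stabP kg /forallP h] | [kg h]].
  by split=> // a aN; apply/eqP/(implyP (h a)).
split; first exact/key_stabP.
by apply/forallP => a; apply/implyP => /h ->.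
Qed.

Lemma stab_on_nil : stab_on [::] = [set 1%g].
Proof.
apply/setP => g; rewrite in_set1; apply/stab_onP/eqP => [[_ h] | ->].
  by apply/permP => a; rewrite perm1 h.
by split=> a; rewrite perm1.
Qed.

Lemma stab_on_all (s : seq 'I_r) : (forall i, i \in s) -> stab_on s = key_stab key.
Proof.
move=> s_all; apply/setP => g; apply/stab_onP/key_stabP => [[] // | kg].
by split=> // a; rewrite s_all.
Qed.

Definition cut (i : 'I_r) (g : 'S_n) := restr_perm [set a | comp L a == i] g.

Lemma cutE i (g : 'S_n) a : (forall a, key (g a) = key a) ->
  cut i g a = if comp L a == i then g a else a.
Proof.
move=> kg; rewrite /cut; case: ifP => ca.
  apply: restr_permE; last by rewrite inE.
  by apply/astabsP => b; rewrite !inE /= /aperm (key_comp (kg b)).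
by apply: (out_perm (restr_perm_on _ g)); rewrite inE ca.
Qed.

Lemma big_stab_on_cons (V : nmodType) i s (F : 'S_n -> V) : i \notin s ->
  \sum_(g in stab_on (i :: s)) F g
    = \sum_(h in stab_on s) \sum_(k in stab_on [:: i]) F (h * k)%g.
Proof.
move=> iNs; apply: (@big_mul_split _ _ _ _ _ (cut i)) => [h k | u].
  move=> /stab_onP[hk hs] /stab_onP[kk ki].
  have hkk a : key ((h * k)%g a) = key a by rewrite permM kk hk.
  split.
    apply/stab_onP; split=> // a; rewrite inE negb_or permM => /andP[ai aNs].
    by rewrite hs // ki // inE.
  apply/permP => a; rewrite cutE //; case: eqP => [ai | /eqP ai].
    by rewrite permM hs // ai.
  by rewrite ki // inE.
move=> /stab_onP[uk us]; have cutk a : key (cut i u a) = key a.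
  by rewrite cutE //; case: ifP => _ //; apply: uk.
split.
  apply/stab_onP; split=> // a; rewrite inE => ai.
  by rewrite cutE // (negbTE ai).
have cutVk a : key ((cut i u)^-1 a)%g = key a.
  by rewrite -[in RHS](permKV (cut i u) a) cutk.
apply/stab_onP; split=> [a | a aNs]; rewrite permM; first by rewrite cutVk uk.
apply: (@perm_inj _ (cut i u)); rewrite permKV cutE //.
by case: eqP => // /eqP ai; rewrite us // inE negb_or ai.
Qed.

End PartialStabilizers.


Section SumsOverBlocks.

Variables (C : numClosedFieldType) (n r : nat) (L : layout n r).
Implicit Types (p : {mpoly C[n]}).

Lemma row_key_comp a b : row_key L a = row_key L b -> comp L a = comp L b.
Proof. by case. Qed.

Lemma col_key_comp a b : col_key L a = col_key L b -> comp L a = comp L b.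
Proof. by case. Qed.

Lemma sym_sum_stab_cons i s p : i \notin s ->
  sym_sum (stab_on L (row_key L) (i :: s)) p
  = sym_sum (stab_on L (row_key L) [:: i]) (sym_sum (stab_on L (row_key L) s) p).
Proof.
move=> iNs; rewrite [LHS](big_stab_on_cons row_key_comp _ iNs) exchange_big /=.
apply: eq_bigr => k _; rewrite (raddf_sum (msym k)); apply: eq_bigr => h _.
by rewrite msymMm.
Qed.

Lemma alt_sum_stab_cons i s p : i \notin s ->
  alt_sum (stab_on L (col_key L) (i :: s)) p
  = alt_sum (stab_on L (col_key L) [:: i]) (alt_sum (stab_on L (col_key L) s) p).
Proof.
move=> iNs; rewrite [LHS](big_stab_on_cons col_key_comp _ iNs) exchange_big /=.
apply: eq_bigr => k _; rewrite (raddf_sum (msym k)) scaler_sumr.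
apply: eq_bigr => h _; rewrite /= msymZ scalerA msymMm.
by rewrite odd_permM addbC signr_addb.
Qed.

Lemma stab_on_commute i s g h : i \notin s ->
  g \in stab_on L (row_key L) [:: i] -> h \in stab_on L (col_key L) s ->
  (g * h = h * g)%g.
Proof.
move=> iNs /stab_onP[gk g_fix] /stab_onP[hk h_fix].
have [gc hc] : (forall a, comp L (g a) = comp L a) /\ (forall a, comp L (h a) = comp L a).
  by split=> a; [apply/row_key_comp/gk | apply/col_key_comp/hk].
apply/permP => a; rewrite !permM; have [ai | ai] := eqVneq (comp L a) i.
  by rewrite !h_fix // ?gc ai.
by rewrite !g_fix // ?inE ?hc ?ai.
Qed.

Lemma sym_alt_sumC i s p : i \notin s ->
  sym_sum (stab_on L (row_key L) [:: i]) (alt_sum (stab_on L (col_key L) s) p)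
  = alt_sum (stab_on L (col_key L) s) (sym_sum (stab_on L (row_key L) [:: i]) p).
Proof.
move=> iNs; rewrite /sym_sum /alt_sum.
transitivity (\sum_(g in stab_on L (row_key L) [:: i])
    \sum_(h in stab_on L (col_key L) s) (-1) ^+ odd_perm h *: msym (g * h)%g p).
  apply: eq_bigr => g gR; rewrite (raddf_sum (msym g)); apply: eq_bigr => h hC.
  by rewrite /= msymZ -msymMm (stab_on_commute iNs gR hC).
rewrite exchange_big /=; apply: eq_bigr => h _.
rewrite (raddf_sum (msym h)) scaler_sumr; apply: eq_bigr => g _.
by rewrite /= msymMm.
Qed.

Lemma alt_sym_sumE (A B : {set 'S_n}) p :
  \sum_(g in A) \sum_(h in B) (-1) ^+ odd_perm h *: msym h (msym g p)
  = alt_sum B (sym_sum A p).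
Proof.
rewrite exchange_big /=; apply: eq_bigr => h _.
by rewrite (raddf_sum (msym h)) scaler_sumr.
Qed.

(** Row sums of a component commute with column sums of the others, so that in a
    product of Young symmetrizers the column sums can be gathered on the left. *)
Lemma foldr_block_sums (c : 'I_r -> C) (E : 'I_r -> {mpoly C[n]} -> {mpoly C[n]}) s p :
  (forall i q, E i q = c i *: alt_sum (stab_on L (col_key L) [:: i])
                                (sym_sum (stab_on L (row_key L) [:: i]) q)) ->
  uniq s ->
  foldr E p s = (\prod_(i <- s) c i) *:
    alt_sum (stab_on L (col_key L) s) (sym_sum (stab_on L (row_key L) s) p).
Proof.
move=> EE; elim: s => [_ | i s IH /andP[iNs us]] /=.
  rewrite big_nil scale1r /alt_sum /sym_sum !stab_on_nil !big_set1.
  by rewrite !msym1m odd_perm1 scale1r.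
rewrite EE (IH us) big_cons sym_sumZ alt_sumZ scalerA.
rewrite (sym_alt_sumC _ iNs).
by rewrite -(alt_sum_stab_cons _ iNs) -(sym_sum_stab_cons _ iNs).
Qed.

End SumsOverBlocks.

(** Renaming the entries by s conjugates the row and column groups by s. *)
Section Transport.

Variables (C : numClosedFieldType) (n : nat) (KT : eqType) (k k' : 'I_n -> KT).
Variables (s : 'S_n).
Hypothesis ks : forall a, k' (s a) = k a.

Lemma key_stabJ g : (g ^ s \in key_stab k')%g = (g \in key_stab k).
Proof.
apply/key_stabP/key_stabP => h a.
  by have := h (s a); rewrite permJ !ks.
by rewrite -[a](permKV s) permJ !ks.
Qed.

Lemma sym_sum_transport (p : {mpoly C[n]}) :
  sym_sum (key_stab k') (msym s p) = msym s (sym_sum (key_stab k) p).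
Proof.
rewrite /sym_sum (reindex_inj (conjg_inj s)) (raddf_sum (msym s)) /=.
apply: eq_big => [g | g _]; first by rewrite key_stabJ.
by rewrite -!msymMm /conjg mulKVg.
Qed.

Lemma alt_sum_transport (p : {mpoly C[n]}) :
  alt_sum (key_stab k') (msym s p) = msym s (alt_sum (key_stab k) p).
Proof.
rewrite /alt_sum (reindex_inj (conjg_inj s)) (raddf_sum (msym s)) /=.
apply: eq_big => [g | g _]; first by rewrite key_stabJ.
by rewrite msymZ -!msymMm /conjg mulKVg odd_permJ.
Qed.

End Transport.

(** * Layouts of natural standard tableaux *)

Lemma cell_inj (s : seq nat) (c c' : cell s) :
  crow c = crow c' -> ccol c = ccol c' -> c = c'.
Proof.
case: c => p q; case: c' => p' q'; rewrite /crow /ccol /= => /val_inj pp.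
by case: p' / pp q' => q' /val_inj->.
Qed.

Section TableauLayout.

Variables (r : nat) (ns : 'I_r -> nat) (lam : rdiagram ns).
Local Notation n := (ntot ns).
Implicit Types (T : rtableau lam).

Definition layout_of T (L : layout n r) : Prop :=
  [/\ forall i c, [/\ comp L (T i c) = i, row L (T i c) = crow c
                    & col L (T i c) = ccol c],
      forall k, exists b : {i : 'I_r & cell (sval (lam i))},
        T (tag b) (tagged b) = k
    & forall k i, (k \in block ns i) = (comp L k == i)].

Lemma cell_below (i : 'I_r) (c : cell (sval (lam i))) p q :
  (p <= crow c)%N -> (q <= ccol c)%N ->
  exists c' : cell (sval (lam i)), crow c' = p /\ ccol c' = q.
Proof.
move=> lep leq_q; have /and3P[srt _ _] := valP (lam i).
have lt_p : (p < size (sval (lam i)))%N := leq_ltn_trans lep (ltn_ord (tag c)).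
have lt_q : (q < nth 0 (sval (lam i)) p)%N.
  apply: leq_ltn_trans leq_q (leq_trans (ltn_ord (tagged c)) _).
  have geq_trans : transitive geq by move=> a b d /= ab da; apply: leq_trans da ab.
  by apply: (sorted_leq_nth geq_trans (fun a => leqnn a) 0 srt) lep => //;
    rewrite inE ?ltn_ord.
by exists (existT _ (Ordinal lt_p) (Ordinal lt_q)).
Qed.

Lemma NST_layout T : T \in NST lam -> exists L, layout_of T L.
Proof.
rewrite !inE => /andP[/andP[/forallP T_bij _] /forallP T_nat].
pose ent (b : {i : 'I_r & cell (sval (lam i))}) := T (tag b) (tagged b).
pose box i c : {i : 'I_r & cell (sval (lam i))} := existT _ i c.
have posP k : exists b, ent b = k.
  have /cards1P[b bE] := T_bij k.
  by exists b; have := set11 b; rewrite -bE inE => /eqP.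
have ent_inj b b' : ent b = ent b' -> b = b'.
  move=> bb; have /cards1P[d dE] := T_bij (ent b).
  have : b \in [set d] by rewrite -dE inE.
  have : b' \in [set d] by rewrite -dE inE -/(ent b') bb.
  by rewrite !inE => /eqP-> /eqP.
have [pos posK] := fin_all_exists posP.
have entK b : pos (ent b) = b by apply: ent_inj; rewrite posK.
pose cmp k := tag (pos k).
pose rw k := crow (tagged (pos k)).
pose cl k := ccol (tagged (pos k)).
have inj a b : cmp a = cmp b -> rw a = rw b -> cl a = cl b -> a = b.
  rewrite /cmp /rw /cl => cab rab qab; apply: (can_inj posK).
  move: (pos a) (pos b) cab rab qab => [i c] [j c'] /= ij.
  by case: j / ij c' => c' rr cc; rewrite (cell_inj rr cc).
have closed a p q : (p <= rw a)%N -> (q <= cl a)%N ->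
    exists b, [/\ cmp b = cmp a, rw b = p & cl b = q].
  move=> lep leq_q; have [c' [rc cc]] := cell_below lep leq_q.
  by exists (ent (box _ c')); rewrite /cmp /rw /cl entK.
exists (Layout inj closed); split=> [i c | k | k i] /=.
- have := entK (box _ c); rewrite /ent /= /cmp /rw /cl => ->.
  by [].
- by exists (pos k); rewrite -[RHS]posK.
rewrite -(eqP (T_nat i)); apply/imsetP/eqP => [[c _ ->] | <-].
  by have := entK (box _ c); rewrite /ent /= /cmp => ->.
by exists (tagged (pos k)) => //; rewrite -[LHS]posK.
Qed.

Section WithLayout.

Variables (T : rtableau lam) (L : layout n r).
Hypothesis TL : layout_of T L.

Lemma comp_groupE : comp_group L = young_subgroup ns :> {set _}.
Proof.
have [_ _ blockE] := TL; apply/setP => g; apply/key_stabP/young_subgroupP => h.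
  by move=> i a; rewrite !blockE h.
by move=> a; apply/eqP; rewrite -blockE h blockE.
Qed.

Lemma layout_cover k : exists i, k \in block ns i.
Proof. by have [_ _ blockE] := TL; exists (comp L k); rewrite blockE. Qed.

Lemma entry_set i : [set T i c | c : cell (sval (lam i))] = [set k | comp L k == i].
Proof.
have [TLE T_ent _] := TL; apply/setP => k; rewrite inE; apply/imsetP/eqP.
  by case=> c _ ->; have [] := TLE i c.
have [[j c] /= <-] := T_ent k; have [-> _ _] := TLE j c => ji.
by case: i / ji; exists c.
Qed.

(** Row and column stabilizers are treated at once: f is the row number, or the
    column number, of a cell. *)
Lemma line_stabE i (f : cell (sval (lam i)) -> nat) (fL : 'I_n -> nat) (g : 'S_n) :
  (forall c, fL (T i c) = f c) ->
  (perm_on [set T i c | c : cell (sval (lam i))] g &&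
     [forall c0, g @: [set T i c | c : cell (sval (lam i)) & f c == f c0]
              == [set T i c | c : cell (sval (lam i)) & f c == f c0]])
  = (g \in stab_on L (fun k => (comp L k, fL k)) [:: i]).
Proof.
move=> fLE; have [TLE T_ent _] := TL.
have lineE x : [set T i c | c : cell (sval (lam i)) & f c == x]
    = [set k | (comp L k == i) && (fL k == x)].
  apply/setP => k; rewrite inE; apply/imsetP/andP.
    by case=> c; rewrite inE -fLE => /eqP <- ->; have [-> _ _] := TLE i c.
  case=> ki kx; have : k \in [set k | comp L k == i] by rewrite inE.
  by rewrite -entry_set => /imsetP[c _ kE]; exists c => //; rewrite inE -fLE -kE.
rewrite entry_set; apply/andP/stab_onP.
  case=> g_on /forallP h; split=> [a | a]; last first.
    by rewrite inE => ai; apply: (out_perm g_on); rewrite inE.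
  have [ai | ai] := boolP (comp L a == i); last by rewrite (out_perm g_on) // inE.
  have : a \in [set k | comp L k == i] by rewrite inE.
  rewrite -entry_set => /imsetP[c _ aE]; have /eqP := h c; rewrite lineE => hE.
  have : g a \in g @: [set k | (comp L k == i) && (fL k == f c)].
    by apply: imset_f; rewrite inE ai aE fLE eqxx.
  by rewrite hE inE => /andP[/eqP-> /eqP->]; rewrite (eqP ai) aE fLE.
case=> gk g_fix; split.
  apply/subsetP => a; rewrite !inE; apply: contraNT => ai.
  by rewrite g_fix // inE.
apply/forallP => c0; rewrite lineE eqEcard card_imset ?leqnn ?andbT; last exact: perm_inj.
apply/subsetP => _ /imsetP[a + ->]; rewrite !inE.
by have [-> ->] := gk a.
Qed.

Lemma row_stabE i : row_stab (T i) = stab_on L (row_key L) [:: i].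
Proof.
apply/setP => g; rewrite -(line_stabE (f := @crow _)) ?inE //.
by move=> c; have [TLE _ _] := TL; have [] := TLE i c.
Qed.

Lemma col_stabE i : col_stab (T i) = stab_on L (col_key L) [:: i].
Proof.
apply/setP => g; rewrite -(line_stabE (f := @ccol _)) ?inE //.
by move=> c; have [TLE _ _] := TL; have [] := TLE i c.
Qed.

Variable R : realType.

Definition young_coef : R[i] :=
  \prod_(i <- enum 'I_r)
    ((nb_std (sval (lam i)))%:R / ((sumn (sval (lam i)))`!)%:R).

Lemma young_rsymE (p : {mpoly R[i][n]}) :
  young_rsym T p = young_coef *: alt_sum (col_group L) (sym_sum (row_group L) p).
Proof.
have E i q : young_sym (T i) q = ((nb_std (sval (lam i)))%:R
      / ((sumn (sval (lam i)))`!)%:R) *: alt_sum (stab_on L (col_key L) [:: i])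
        (sym_sum (stab_on L (row_key L) [:: i]) q) :> {mpoly R[i][n]}.
  by rewrite /young_sym row_stabE col_stabE alt_sym_sumE.
apply: etrans (foldr_block_sums p E (enum_uniq _)) _.
by rewrite !stab_on_all // => i; rewrite mem_enum.
Qed.

End WithLayout.

End TableauLayout.

(** * The module of higher Specht polynomials *)

Lemma lin_closed_sum (C : fieldType) (V : lmodType C) (W : V -> Prop)
    (I : finType) (P : pred I) (f : I -> V) :
  W 0 -> (forall c p q, W p -> W q -> W (c *: p + q)) ->
  (forall i, P i -> W (f i)) -> W (\sum_(i | P i) f i).
Proof.
move=> W0 Wlin Wf; apply: big_ind => // p q Wp Wq.
by rewrite -[p]scale1r; apply: Wlin.
Qed.

Lemma lin_closedZ (C : fieldType) (V : lmodType C) (W : V -> Prop) c p :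
  W 0 -> (forall c p q, W p -> W q -> W (c *: p + q)) -> W p -> W (c *: p).
Proof. by move=> W0 Wlin Wp; rewrite -[_ *: _]addr0; apply: Wlin. Qed.

Lemma orbit_span0 (C : numClosedFieldType) n r (L : layout n r) (F : {mpoly C[n]}) :
  orbit_span L F 0.
Proof. by exists (fun=> 0); rewrite big1 // => g _; rewrite scale0r. Qed.

Lemma orbit_spanP (C : numClosedFieldType) n r (L : layout n r)
    (F : {mpoly C[n]}) c p q :
  orbit_span L F p -> orbit_span L F q -> orbit_span L F (c *: p + q).
Proof.
move=> [a ->] [b ->]; exists (fun g => c * a g + b g).
rewrite scaler_sumr -big_split; apply: eq_bigr => g _ /=.
by rewrite scalerA scalerDl.
Qed.

Lemma orbit_span_msym (C : numClosedFieldType) n r (L : layout n r)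
    (F : {mpoly C[n]}) (s : 'S_n) :
  s \in comp_group L -> orbit_span L F (msym s F).
Proof.
move=> sG; exists (fun g => (g == s)%:R); rewrite (bigD1 s) //= eqxx scale1r.
by rewrite big1 ?addr0 // => g /andP[_ /negbTE->]; rewrite scale0r.
Qed.

Lemma msym_prod_powers (C : comNzRingType) n (s : 'S_n) (I : finType) (J : I -> finType)
    (t t' : forall i, J i -> 'I_n) (e : forall i, J i -> nat) :
  (forall i c, t' i c = s (t i c)) ->
  \prod_i \prod_(c : J i) 'X_(t' i c) ^+ e i c
  = msym s (\prod_i \prod_(c : J i) 'X_(t i c) ^+ e i c) :> {mpoly C[n]}.
Proof.
move=> tt'; rewrite (rmorph_prod (msym s)); apply: eq_bigr => i _.
rewrite (rmorph_prod (msym s)); apply: eq_bigr => c _.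
by rewrite (rmorphXn (msym s)) /= msymXU tt'.
Qed.

Section SpechtModule.

Variables (R : realType) (r : nat) (ns : 'I_r -> nat) (lam : rdiagram ns).
Variable S : rtableau lam.
Local Notation n := (ntot ns).
Implicit Types (T : rtableau lam) (p q : {mpoly R[i][n]}) (s : 'S_n).

Lemma higher_specht_transport T T' L L' s :
  layout_of T L -> layout_of T' L' -> (forall i c, T' i c = s (T i c)) ->
  higher_specht R T' S = msym s (higher_specht R T S).
Proof.
move=> TL TL' TT'; rewrite /higher_specht (young_rsymE TL) (young_rsymE TL').
rewrite msymZ; congr (_ *: _).
have [LE T_ent _] := TL; have [LE' _ _] := TL'.
have keys a : [/\ comp L' (s a) = comp L a, row L' (s a) = row L a
                & col L' (s a) = col L a].
  have [[i c] /= <-] := T_ent a; rewrite -TT'.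
  by have [-> -> ->] := LE i c; have [-> -> ->] := LE' i c.
have -> : specht_monomial R T' S = msym s (specht_monomial R T S).
  exact: msym_prod_powers.
rewrite (@sym_sum_transport _ _ _ (row_key L)); last first.
  by move=> a; rewrite /row_key; have [-> -> _] := keys a.
rewrite (@alt_sum_transport _ _ _ (col_key L)) //.
by move=> a; rewrite /col_key; have [-> _ ->] := keys a.
Qed.

Definition tab_act s T : rtableau lam := [ffun i => [ffun c => s (T i c)]].

Lemma tab_actE s T i c : tab_act s T i c = s (T i c).
Proof. by rewrite !ffunE. Qed.

(** The condition [standard_for] is stated on entries, but it is tailored to this:
    the fillings at which straightening stops are natural standard tableaux. *)
Lemma tab_act_NST T L s : T \in NST lam -> layout_of T L ->
  s \in comp_group L -> standard_for L s -> tab_act s T \in NST lam.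
Proof.
move=> TN TL sG s_std; have [LE T_ent blockE] := TL.
move: TN; rewrite !inE => /andP[/andP[/forallP T_bij _] /forallP T_nat].
apply/andP; split; [apply/andP; split |].
- apply/forallP => k; rewrite -(eqP (T_bij (s^-1 k)%g)); apply/eqP.
  by apply: eq_card => b; rewrite !inE tab_actE (canF_eq (permK s)).
- apply/forallP => i; apply/forallP => c; apply/forallP => c'; apply/implyP => cc.
  rewrite !tab_actE; have [ci ri qi] := LE i c; have [ci' ri' qi'] := LE i c'.
  apply: s_std; first by rewrite ci ci'.
  rewrite ri ri' qi qi'.
  by case/orP: cc => /andP[/eqP E lt]; [left | right].
apply/forallP => i; have /young_subgroupP sB : s \in young_subgroup ns.
  by rewrite -(comp_groupE TL).
apply/eqP/setP => k; apply/imsetP/idP => [[c _ ->] | kB].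
  by rewrite tab_actE sB -(eqP (T_nat i)) imset_f.
have : (s^-1 k)%g \in block ns i by rewrite -sB permKV.
rewrite -(eqP (T_nat i)) => /imsetP[c _ kE]; exists c => //.
by rewrite tab_actE -kE permKV.
Qed.

Lemma NST_conjugate T T' L : T' \in NST lam -> layout_of T L ->
  exists2 s, s \in comp_group L & forall i c, T' i c = s (T i c).
Proof.
move=> T'N TL; have [L' TL'] := NST_layout T'N.
have [LE T_ent blockE] := TL; have [LE' _ blockE'] := TL'.
have [pos posK] := fin_all_exists T_ent.
pose f k := T' (tag (pos k)) (tagged (pos k)).
have fE k : [/\ comp L' (f k) = comp L k, row L' (f k) = row L k
              & col L' (f k) = col L k].
  rewrite -{2 4 6}(posK k) /f; case: (pos k) => [i c] /=.
  by have [-> -> ->] := LE i c; have [-> -> ->] := LE' i c.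
have f_inj : injective f.
  move=> a b fab; have [ca ra qa] := fE a; have [cb rb qb] := fE b.
  by apply: (@layout_inj _ _ L); rewrite -?ca -?ra -?qa fab.
exists (perm f_inj).
  apply/key_stabP => a; rewrite permE; apply/eqP; rewrite -blockE blockE'.
  by have [-> _ _] := fE a.
move=> i c; rewrite permE; have [cc rc qc] := LE i c.
have [cf rf qf] := fE (T i c); have [c' r' q'] := LE' i c.
by apply: (@layout_inj _ _ L'); rewrite ?c' ?r' ?q' ?cf ?rf ?qf ?cc ?rc ?qc.
Qed.

(** [specht_module] at the level of polynomials rather than fractions. *)
Definition specht_span p : Prop := exists a : rtableau lam -> R[i],
  p = \sum_(T in NST lam) a T *: higher_specht R T S.

Lemma specht_spanE f : specht_module R S f <-> exists2 p, specht_span p & f = tofrac p.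
Proof.
split; first by case=> a ->; eexists; [exists a |].
by case=> p [a ->] ->; exists a.
Qed.

Lemma specht_span0 : specht_span 0.
Proof. by exists (fun=> 0); rewrite big1 // => T _; rewrite scale0r. Qed.

Lemma specht_span_lin c p q :
  specht_span p -> specht_span q -> specht_span (c *: p + q).
Proof.
move=> [a ->] [b ->]; exists (fun T => c * a T + b T).
rewrite scaler_sumr -big_split; apply: eq_bigr => T _ /=.
by rewrite scalerA scalerDl.
Qed.

Lemma specht_span_NST T : T \in NST lam -> specht_span (higher_specht R T S).
Proof.
move=> TN; exists (fun T' => (T' == T)%:R); rewrite (bigD1 T) //= eqxx scale1r.
by rewrite big1 ?addr0 // => g /andP[_ /negbTE->]; rewrite scale0r.
Qed.

Section FixedTableau.

Variables (T : rtableau lam) (L : layout n r).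
Hypotheses (TN : T \in NST lam) (TL : layout_of T L).

Let F := alt_sum (col_group L) (sym_sum (row_group L) (specht_monomial R T S)).

Lemma higher_spechtE : higher_specht R T S = young_coef lam R *: F.
Proof. exact: young_rsymE. Qed.

(** The predicate given to straightening carries the scalar of the Young
    symmetrizer, so as to avoid dividing by it. *)
Lemma specht_span_translate s :
  s \in comp_group L -> specht_span (msym s (higher_specht R T S)).
Proof.
move=> sG; rewrite higher_spechtE msymZ.
apply: (@straightening _ _ _ L (fun p => specht_span (young_coef lam R *: p))) sG.
- move=> c p q hp hq; rewrite scalerDr scalerA mulrC -scalerA.
  exact: specht_span_lin.
- by rewrite scaler0; apply: specht_span0.
move=> {}s sG s_std; rewrite -msymZ -higher_spechtE.
have sTN := tab_act_NST TN TL sG s_std; have [L' sTL] := NST_layout sTN.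
rewrite -(higher_specht_transport TL sTL); first exact: specht_span_NST.
exact: tab_actE.
Qed.

Lemma higher_specht_conjugate T' : T' \in NST lam ->
  exists2 s, s \in comp_group L & higher_specht R T' S = msym s (higher_specht R T S).
Proof.
move=> T'N; have [s sG sE] := NST_conjugate T'N TL; exists s => //.
have [L' TL'] := NST_layout T'N; exact: higher_specht_transport TL TL' sE.
Qed.

Lemma specht_span_msym s p :
  s \in young_subgroup ns -> specht_span p -> specht_span (msym s p).
Proof.
rewrite -(comp_groupE TL) => sG [a ->]; rewrite (raddf_sum (msym s)).
apply: lin_closed_sum specht_span0 specht_span_lin _ => T' T'N.
rewrite /= msymZ; apply: lin_closedZ specht_span0 specht_span_lin _.
have [t tG ->] := higher_specht_conjugate T'N; rewrite -msymMm.
by apply: specht_span_translate; rewrite groupM.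
Qed.

Lemma specht_span_orbit p : specht_span p -> orbit_span L F p.
Proof.
move=> [a ->]; have lin := @orbit_spanP _ _ _ L F; have z := orbit_span0 L F.
apply: (lin_closed_sum z lin) => T' T'N; apply: (lin_closedZ _ z lin).
have [t tG ->] := higher_specht_conjugate T'N.
rewrite higher_spechtE msymZ; apply: (lin_closedZ _ z lin).
exact: orbit_span_msym.
Qed.

(** Irreducibility of V^S(lambda): since V is spanned by translates of
    the single polynomial F, it is an instance of [young_irreducible]. *)
Lemma specht_span_irreducible (K : {mpoly R[i][n]} -> Prop) v :
  (forall c p q, K p -> K q -> K (c *: p + q)) ->
  (forall s p, s \in young_subgroup ns -> K p -> K (msym s p)) ->
  specht_span v -> K v -> v != 0 -> K (higher_specht R T S).
Proof.
move=> Klin Ksym /specht_span_orbit vF Kv v0.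
have K0 : K 0 by have := Klin (-1) v v Kv Kv; rewrite scaleN1r addNr.
rewrite higher_spechtE; apply: (lin_closedZ _ K0 Klin).
apply: young_irreducible Klin _ vF Kv v0 => s p.
by rewrite (comp_groupE TL); apply: Ksym.
Qed.

End FixedTableau.

End SpechtModule.

Theorem theorem3p18 (R : realType) (r : nat) (ns : 'I_r -> nat)
    (ns_gt0 : forall i, (0 < ns i)%N)
    (y : (ntot ns).-tuple {mpoly R[i][ntot ns]}) (hy : invariant_coords y)
    (dy : 'I_(ntot ns) -> ratfun R (ntot ns) -> ratfun R (ntot ns))
    (hdy : forall j, is_ddy y j (dy j))
    (lam : rdiagram ns) (T S : rtableau lam)
    (hT : T \in NST lam) (hS : S \in ST lam)
    (D : ratfun R (ntot ns) -> ratfun R (ntot ns)) (hD : in_DV y dy D)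
    (hDF : D (tofrac (higher_specht R T S)) != 0) :
  CG_isomorphic (image_of D (specht_module R S)) (specht_module R S).
Proof.
have [L TL] := NST_layout hT.
have [_ Dlin Dact] := DV_equivariant (layout_cover TL) hy hdy hD.
have Olin (c : R[i]) (p q : {mpoly R[i][ntot ns]}) :
    tofrac (c *: p + q) = cst (ntot ns) c * tofrac p + tofrac q.
  by rewrite tofracD tofracZ.
have Dlin' (c : R[i]) (p q : {mpoly R[i][ntot ns]}) :
    D (tofrac (c *: p + q)) = cst (ntot ns) c * D (tofrac p) + D (tofrac q).
  by rewrite Olin Dlin //; apply: OU_tofrac.
have D0 : D 0 = 0.
  have := Dlin' (-1) 0 0; rewrite scaler0 addr0 tofrac0 /cst => ->.
  by rewrite mpolyCN mpolyC1 tofracN tofrac1 mulN1r addNr.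
have Dact' s (p : {mpoly R[i][ntot ns]}) : s \in young_subgroup ns ->
    D (tofrac (msym s p)) = act s (D (tofrac p)).
  by move=> sG; rewrite -act_tofrac Dact //; apply: OU_tofrac.
pose W := @specht_span R r ns lam S.
have Wmod f : specht_module R S f <-> exists2 p, W p & f = tofrac p.
  exact: specht_spanE.
(* The kernel of D does not contain the generator, hence it is zero. *)
have ker v : W v -> D (tofrac v) = 0 -> v = 0.
  move=> Wv Dv; apply/eqP; apply: contraNT hDF => v0; apply/eqP.
  apply: (specht_span_irreducible TL (K := fun p => D (tofrac p) = 0)
           _ _ Wv Dv v0).
    by move=> c p q Dp Dq; rewrite Dlin' Dp Dq mulr0 addr0.
  by move=> s p sG Dp; rewrite Dact' // Dp raddf0.
have inj p q : W p -> W q -> D (tofrac p) = D (tofrac q) -> p = q.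
  move=> Wp Wq Dpq; apply/eqP; rewrite -subr_eq0 addrC -scaleN1r; apply/eqP/ker.
    exact: specht_span_lin.
  by rewrite Dlin' Dpq /cst mpolyCN mpolyC1 tofracN tofrac1 mulN1r addNr.
have modV : is_CGmodule (specht_module R S).
  split.
  - by apply/Wmod; exists 0; [exact: specht_span0 | rewrite tofrac0].
  - move=> c f g /Wmod[p Wp ->] /Wmod[q Wq ->]; apply/Wmod.
    by exists (c *: p + q); [exact: specht_span_lin | rewrite Olin].
  move=> s f sG /Wmod[p Wp ->]; apply/Wmod.
  by exists (msym s p); [exact: specht_span_msym hT TL _ _ sG Wp | rewrite act_tofrac].
have imP g : image_of D (specht_module R S) g <-> exists2 p, W p & g = D (tofrac p).
  split; first by case=> f /Wmod[p Wp ->] ->; exists p.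
  by case=> p Wp ->; exists (tofrac p) => //; apply/Wmod; exists p.
(* A set-theoretic inverse of D on its image; it is then shown to be linear and
   equivariant because D is. *)
have [phi phiP] : exists phi : ratfun R (ntot ns) -> {mpoly R[i][ntot ns]},
    forall p, W p -> phi (D (tofrac p)) = p.
  suff pre g : exists p, forall q, W q -> g = D (tofrac q) -> p = q.
    by have [phi phiP] := boolp.choice pre; exists phi => p Wp; apply: phiP.
  have [[p Wp ->] | no] := boolp.EM (exists2 p, W p & g = D (tofrac p)).
    by exists p => q Wq; apply: inj.
  by exists 0 => q Wq gq; case: no; exists q.
split=> //.
  split.
  - by apply/imP; exists 0; [exact: specht_span0 | rewrite tofrac0 D0].
  - move=> c f g /imP[p Wp ->] /imP[q Wq ->]; apply/imP.
    by exists (c *: p + q); [exact: specht_span_lin | rewrite Dlin'].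
  move=> s f sG /imP[p Wp ->]; apply/imP.
  by exists (msym s p); [exact: specht_span_msym hT TL _ _ sG Wp | rewrite Dact'].
exists (fun g => tofrac (phi g)); split.
- by move=> f /imP[p Wp ->]; apply/Wmod; exists p => //; rewrite phiP.
- move=> c f g /imP[p Wp ->] /imP[q Wq ->]; rewrite -Dlin' !phiP //.
  exact: specht_span_lin.
- move=> s f sG /imP[p Wp ->]; rewrite act_tofrac -Dact' // !phiP //.
  exact: specht_span_msym hT TL _ _ sG Wp.
- move=> f g /imP[p Wp ->] /imP[q Wq ->]; rewrite !phiP // => /eqP.
  by rewrite tofrac_eq => /eqP->.
move=> g /Wmod[p Wp ->]; exists (D (tofrac p)); first by apply/imP; exists p.
by rewrite phiP.
Qed.
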